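(* Let $G$ be a bridgeless outerplanar graph of order $n$ with diameter $3$. Then $3\leq rc(G)\leq 6$.
   Context: All graphs are simple, finite and undirected. A graph is outerplanar if it can be embedded in the plane so that all vertices lie on a common face. An edge-colored graph is rainbow connected if every two vertices are joined by a path whose edges have pairwise distinct colors. The rainbow connection number $rc(G)$ of a connected graph $G$ is the smallest number of colors in an edge-coloring of $G$ that makes $G$ rainbow connected. *)

(* Defs.v *)
From mathcomp Require Import all_boot all_fingroup.
Set Implicit Arguments. Unset Strict Implicit. Unset Printing Implicit Defensive.

Section Graphs.
Variable T : finType.

Definition simple_graph (e : rel T) : Prop := symmetric e /\ irreflexive e.

Definition connected_graph (e : rel T) : Prop := forall x y : T, connect e x y.

Definition walk (e : rel T) (x y : T) (p : seq T) : bool :=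
  path e x p && (last x p == y).

Definition dist_le (e : rel T) (x y : T) (d : nat) : Prop :=
  exists p, walk e x y p /\ size p <= d.

Definition diameter_eq (e : rel T) (d : nat) : Prop :=
  (forall x y, dist_le e x y d) /\ (exists x y, ~ dist_le e x y d.-1) /\ 0 < d.

Definition remove_edge (e : rel T) (u v : T) : rel T :=
  fun a b => e a b && ~~ (((a == u) && (b == v)) || ((a == v) && (b == u))).

Definition bridgeless (e : rel T) : Prop :=
  forall u v, e u v -> connect (remove_edge e u v) u v.

Definition rotation_system (e : rel T) (rot : T -> {perm T}) : Prop :=
  forall v,
    (forall u, ~~ e v u -> rot v u = u) /\
    (forall u w, e v u -> e v w -> fconnect (rot v) u w).

Definition dart (e : rel T) : pred (T * T) := fun d => e d.1 d.2.

Definition face_step (e : rel T) (rot : T -> {perm T}) (d : T * T) : T * T :=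
  if e d.1 d.2 then (d.2, rot d.2 d.1) else d.

Definition nfaces (e : rel T) (rot : T -> {perm T}) : nat :=
  fcard (face_step e rot) (dart e).

(* Euler's formula V - E + F = 2 (with 2E = #darts): the rotation system
   describes an embedding of the (connected) graph in the sphere/plane. *)
Definition planar_rotation (e : rel T) (rot : T -> {perm T}) : Prop :=
  rotation_system e rot /\ 2 * #|T| + 2 * nfaces e rot = #|dart e| + 4.

(* Outerplanar (for a connected graph with at least one edge): a plane
   embedding having a face whose boundary walk meets every vertex. *)
Definition outerplanar (e : rel T) : Prop :=
  exists rot : T -> {perm T}, planar_rotation e rot /\
    exists d0, dart e d0 /\
      forall x : T, exists y : T,
        dart e (x, y) /\ fconnect (face_step e rot) d0 (x, y).

(* An edge colouring with (at most) k colours; symmetric so that each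
   undirected edge gets one colour. *)
Definition edge_colouring (e : rel T) (k : nat) (c : T -> T -> 'I_k) : Prop :=
  forall u v, e u v -> c u v = c v u.

Definition path_colours k (c : T -> T -> 'I_k) (x : T) (p : seq T) : seq 'I_k :=
  [seq c ab.1 ab.2 | ab <- zip (x :: p) p].

Definition rainbow_connected (e : rel T) k (c : T -> T -> 'I_k) : Prop :=
  forall x y : T, exists p : seq T,
    walk e x y p /\ uniq (x :: p) /\ uniq (path_colours c x p).

Definition rc_colourable (e : rel T) (k : nat) : Prop :=
  exists c : T -> T -> 'I_k, edge_colouring e c /\ rainbow_connected e c.

Definition is_rc (e : rel T) (k : nat) : Prop :=
  rc_colourable e k /\ forall j, j < k -> ~ rc_colourable e j.

End Graphs.

(* Main.v *)
Require Import Defs.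
From mathcomp Require Import all_boot all_fingroup.
From mathcomp Require Import zify.
From Stdlib Require Import Classical.
Set Implicit Arguments. Unset Strict Implicit. Unset Printing Implicit Defensive.

(** From a plane embedding with a face meeting every vertex, the first visits of that face
    give a cyclic order of the vertices for which no two edges cross: if [ac] and [bd]
    crossed, cutting the vertices [a] and [c] open along the edge [ac] and along the outer
    face would yield a connected map violating the genus inequality.

    In such a chord diagram of diameter 3, either some edge has every vertex within distance
    2 of one of its ends, or there is an induced cycle of length 5, 6 or 7. To see this, take
    [v] with a vertex [z] at distance 3 and let [K] be the component of [z] in [G - N[v]]. It
    is attached to at most two neighbours [u], [u'] of [v]; every other vertex is close to
    them, and if neither [uu'] nor an edge through a common neighbour of [u] and [u'] in [K]
    is central, a path from [u] to [u'] through [K] closes up with [v] to the induced cycle.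
    For a central edge, at most two of its neighbours are needed to dominate the graph, since
    the middle one of three would separate the private neighbours of the other two. An
    induced 5- or 6-cycle is dominating, and an induced 7-cycle is the whole graph.

    Hence, apart from the 7-cycle, which needs only 4 colours, there is a connected
    dominating set that is rainbow connected with 3 colours; as all degrees are at least 2,
    3 further colours suffice for the whole graph. *)

(** * Genus inequality for permutations *)

Section PermutationGenus.
Variable X : finType.
Implicit Types (s t : {perm X}) (A R : {set X}).
Local Open Scope group_scope.

Definition stable s A := [forall a in A, s a \in A].

(* [R] meets every orbit of the group generated by [s] and [t]. *)
Definition generates s t R :=
  [forall A : {set X}, [&& R \subset A, stable s A & stable t A] ==> (A == setT)].

(** Inversion preserves orbits and turns right multiplication by a transposition into left
    multiplication. The transposition splits a cycle through both points and merges two different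
    cycles. *)
Lemma card_porbits_mulr_tperm s x y :
  (#|porbits (s * tperm x y)| + (x \notin porbit s y).*2 = #|porbits s| + (x != y))%N.
Proof.
have := porbits_mul_tperm s^-1 x y; rewrite /= porbitV porbitsV => <-.
by rewrite -porbitsV invMg tpermV.
Qed.

Lemma stable_porbit s A x y : stable s A -> y \in porbit s x -> x \in A -> y \in A.
Proof.
move=> /forall_inP sA /porbitP [i ->] xA.
by elim: i => [|i IH]; rewrite ?perm1 // expgSr permM sA.
Qed.

(* Euler's inequality: [s], [t] and [s * t] are the vertices, edges and faces of a map, and
   [R] bounds the number of its components. Induction on the support of [t]: splitting off
   a fixed point [x] from a cycle of [t] either splits a cycle of [s * t], and then at most
   one more component appears, or merges two of them, and then none does. *)
Lemma card_porbits_generates s t R :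
  generates s t R ->
  (#|porbits s| + #|porbits t| + #|porbits (s * t)| <= #|X| + #|R|.*2)%N.
Proof.
have [n] := ubnP #|[set a | t a != a]|; elim: n t R => // n IH t R le_n gen.
(* For [t = 1] every [s]-orbit meets [R], because the points whose orbit meets [R] form a stable
   set. *)
have [t1|] := boolP [forall a, t a == a].
  have -> : t = 1 by apply/permP=> a; rewrite perm1; apply/eqP/(forallP t1).
  have sR : (#|porbits s| <= #|R|)%N.
    apply: leq_trans (leq_imset_card (porbit s) _); apply/subset_leq_card/subsetP => o.
    case/imsetP=> x _ ->.
    pose A := [set a | porbit s a \in [set porbit s x | x in R]].
    have /forallP/(_ A)/implyP : generates s t R by [].
    suff h : [&& R \subset A, stable s A & stable t A].
      by move/(_ h)/eqP/setP/(_ x); rewrite !inE.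
    apply/and3P; split.
    - by apply/subsetP=> a aR; rewrite inE imset_f.
    - apply/forall_inP=> a; rewrite !inE.
      by have /eqP <- : porbit s a == porbit s (s a) by rewrite eq_porbit_mem porbit_sym (mem_porbit s 1).
    - by apply/forall_inP=> a aA; rewrite (eqP (forallP t1 a)).
  rewrite mulg1 addnAC addnn addnC leq_add ?leq_double //.
  exact: leq_imset_card.
rewrite negb_forall => /existsP [x tx]; pose t' := t * tperm x (t x).
have t'E a : t' a = tperm x (t x) (t a) by rewrite permM.
have ctt' : #|porbits t'| = #|porbits t|.+1.
  have := card_porbits_mulr_tperm t x (t x); rewrite eq_sym tx -/t'.
  by rewrite porbit_sym (mem_porbit t 1) /= addn0 addn1.
have lt' : (#|[set a | t' a != a]| < n)%N.
  apply: leq_trans (_ : (#|[set a | t a != a]| <= n)%N) => //.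
  apply: proper_card; apply/properP; split.
    apply/subsetP=> a; rewrite !inE t'E; apply: contraNN => /eqP ta; rewrite ta.
    by apply/eqP/tpermD; [apply: contraNneq tx => ->; rewrite ta|
      apply: contraNneq tx => e; rewrite -(inj_eq (@perm_inj _ t)) e ta].
  by exists x; rewrite !inE ?t'E ?tpermR ?eqxx.
have Eupd A a : stable t' A -> a \in A -> t a \notin [set x; t x] -> t a \in A.
  move=> /forall_inP/(_ a) sA aA; rewrite !inE negb_or => /andP [n1 n2].
  by move: (sA aA); rewrite t'E tpermD // eq_sym.
(* [t] and [t'] differ only by swapping the values [x] and [t x], so a set not separating these two
   is stable under both or neither. *)
have st A : stable t' A -> (x \in A) = (t x \in A) -> stable t A.
  move=> sA xE; apply/forall_inP=> a aA.
  have [|] := boolP (t a \in [set x; t x]); last exact: Eupd.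
  have := forall_inP sA _ aA; rewrite t'E !inE => h /orP [] /eqP E; move: h; rewrite E.
    by rewrite tpermL -xE.
  by rewrite tpermR xE.
have := card_porbits_mulr_tperm (s * t) x (t x); rewrite eq_sym tx -mulgA -/t'.
have := card_porbits_mulr_tperm (s * t') x (t x); rewrite eq_sym tx.
have -> : s * t' * tperm x (t x) = s * t by rewrite /t' -!mulgA tperm2 mulg1.
case: (boolP (x \in porbit (s * t') (t x))) => /= x1 c1.
  move=> c2; have gen' : generates s t' R.
    apply/forallP=> A; apply/implyP=> /and3P [RA sA tA].
    move/forallP/(_ A)/implyP: gen; apply; rewrite RA sA st //.
    have stA : stable (s * t') A.
      apply/forall_inP => a aA; rewrite permM.
      by apply: (forall_inP tA); apply: (forall_inP sA).
    by apply/idP/idP; apply: (stable_porbit stA); rewrite // porbit_sym.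
  have := IH _ _ lt' gen'; rewrite ctt'.
  by move: c1; rewrite addn0 addn1 => ->; rewrite !addnS addSn.
move=> c2; suff [y gen'] : exists y, generates s t' (y |: R).
  have := IH _ _ lt' gen'; rewrite ctt' cardsU1.
  have ar a b c c' r (d : bool) B : (c + 1.*2 = c' + 1 ->
      a + b.+1 + c' <= B + (d + r).*2 -> a + b + c <= B + r.*2)%N by case: d; lia.
  exact: ar c1.
(* If neither point worked, there would be proper stable sets [A] containing [x] and [B] containing
   [t x]. Each misses the other point, so [A :&: B] misses both; it is then [t]-stable,
   contradicting [gen]. *)
case g1 : (generates s t' (x |: R)); first by exists x.
case g2 : (generates s t' (t x |: R)); first by exists (t x).
move/negbT: g1; rewrite negb_forall => /existsP [A]; rewrite negb_imply.
case/andP=> /and3P [RA sA tA] nA.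
move/negbT: g2; rewrite negb_forall => /existsP [B]; rewrite negb_imply.
case/andP=> /and3P [RB sB tB] nB.
move: RA RB; rewrite !subUset !sub1set => /andP [xA RA] /andP [txB RB].
have notT (C : {set X}) : R \subset C -> stable s C -> stable t' C -> C != setT ->
    (x \in C) = (t x \in C) -> False.
  move=> RC sC tC /negP nC xE; apply: nC.
  by move/forallP/(_ C)/implyP: gen; apply; rewrite RC sC st.
have txA : t x \notin A by apply/negP=> h; apply: (notT A); rewrite ?xA ?h.
have xB : x \notin B by apply/negP=> h; apply: (notT B); rewrite ?txB ?h.
exfalso; apply: (notT (A :&: B)); rewrite ?subsetI ?RA ?RB //.
- by apply/forall_inP=> a /setIP [aA aB]; rewrite inE (forall_inP sA) ?(forall_inP sB).
- by apply/forall_inP=> a /setIP [aA aB]; rewrite inE (forall_inP tA) ?(forall_inP tB).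
- by apply: contraNneq nA => h; rewrite -subTset -h subsetIl.
- by rewrite !inE (negbTE txA) (negbTE xB) andbF.
Qed.

End PermutationGenus.

(** * Darts of a rotation system *)

Section PorbitTools.
Variable X : finType.
Implicit Types (s t : {perm X}) (A R : {set X}).

Lemma porbit_stable s x : stable s (porbit s x).
Proof.
apply/forall_inP=> a; rewrite -eq_porbit_mem => /eqP <-.
exact: (mem_porbit s 1).
Qed.

Lemma stable_mul s t A : stable s A -> stable t A -> stable (s * t)%g A.
Proof.
move=> sA tA; apply/forall_inP=> a aA; rewrite permM.
by rewrite (forall_inP tA) // (forall_inP sA).
Qed.

Lemma porbit_agree s s' A x y :
  stable s A -> {in A, s =1 s'} -> x \in A -> y \in porbit s x -> y \in porbit s' x.
Proof.
move=> sA ss' xA /porbitP [i ->].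
suff /andP [] : ((s ^+ i)%g x \in porbit s' x) && ((s ^+ i)%g x \in A) by [].
elim: i => [|i /andP [IH iA]]; first by rewrite expg0 perm1 porbit_id xA.
rewrite expgSr permM (forall_inP sA) // andbT ss' //.
exact: (forall_inP (porbit_stable s' x)).
Qed.

Lemma stable_iter s s' A x n :
  stable s' A -> x \in A ->
  (forall m, m < n -> s' (iter m s x) = iter m.+1 s x) -> iter n s x \in A.
Proof.
move=> sA xA; elim: n => // n IH h; rewrite -h //.
by apply: (forall_inP sA); apply: IH => m mn; apply: h; apply: ltnW.
Qed.

Lemma mem_tperm A x y z : x \in A -> y \in A -> (tperm x y z \in A) = (z \in A).
Proof. by move=> xA yA; case: tpermP => [->|->|]; rewrite ?xA ?yA. Qed.

End PorbitTools.

Section Rotation.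
Variables (T : finType) (e : rel T) (rot : T -> {perm T}).
Hypotheses (es : symmetric e) (ei : irreflexive e) (rs : rotation_system e rot).
Implicit Types d : T * T.

Lemma sigma_inj : injective (fun d => (d.1, rot d.1 d.2)).
Proof. by move=> [v u] [w z] /= [<-] /perm_inj ->. Qed.
Definition sigma := perm sigma_inj.

Lemma alpha_inj : injective (fun d => if e d.1 d.2 then (d.2, d.1) else d).
Proof.
move=> [v u] [w z] /=; case: ifP => h; case: ifP => h' [] E1 E2; subst => //.
- by rewrite es h in h'.
- by rewrite es h' in h.
Qed.
Definition alpha := perm alpha_inj.
(** On darts, the orbits of [sigma], [alpha] and [phi] are the vertices, edges and faces of the map.
    All other pairs are fixed by the three permutations and have to be carried along in every
    count. *)
Definition phi := (alpha * sigma)%g.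

Lemma rot_adj v u : e v (rot v u) = e v u.
Proof.
have [h _] := rs v; apply/idP/idP; last first.
  by apply: contraTT => n; have /perm_inj E := h _ n; rewrite -E.
by apply: contraTT => n; rewrite h.
Qed.

Lemma dart_sigma d : dart e (sigma d) = dart e d.
Proof. by rewrite permE /dart /= rot_adj. Qed.

Lemma dart_alpha d : dart e (alpha d) = dart e d.
Proof. by rewrite permE /dart /=; case: ifP => //= h; rewrite es h. Qed.

Lemma dart_phi d : dart e (phi d) = dart e d.
Proof. by rewrite permM dart_sigma dart_alpha. Qed.

Lemma sigma_fix d : ~~ dart e d -> sigma d = d.
Proof.
by case: d => v u n; have [h _] := rs v; rewrite permE /= h.
Qed.

Lemma alpha_fix d : ~~ dart e d -> alpha d = d.
Proof. by rewrite permE /dart => /negbTE ->. Qed.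

Lemma phi_fix d : ~~ dart e d -> phi d = d.
Proof. by move=> n; rewrite permM alpha_fix // sigma_fix. Qed.

Lemma phiE d : phi d = face_step e rot d.
Proof.
rewrite /face_step; case: ifP => h; last by rewrite phi_fix // /dart h.
by rewrite permM !permE /= h.
Qed.

Definition nondarts := [set d | ~~ dart e d].

(** Darts and non-darts never share an orbit, and a non-dart is an orbit by itself, so [Q] together
    with the non-darts represents distinct orbits. *)
Lemma card_porbits_darts (s : {perm T * T}) (Q : {set T * T}) :
  (forall d, dart e (s d) = dart e d) -> (forall d, ~~ dart e d -> s d = d) ->
  {in Q, forall d, dart e d} ->
  {in Q &, forall d d', d \in porbit s d' -> d = d'} ->
  #|Q| + #|nondarts| <= #|porbits s|.
Proof.
move=> sd sf Qd Qi.
have pd d d' : d \in porbit s d' -> dart e d = dart e d'.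
  case/porbitP=> i ->; elim: i => [|i IH]; first by rewrite expg0 perm1.
  by rewrite expgSr permM sd.
have pf d d' : ~~ dart e d' -> d \in porbit s d' -> d = d'.
  move=> n /porbitP [i ->]; elim: i => [|i IH]; first by rewrite expg0 perm1.
  by rewrite expgSr permM IH sf.
have dis : [disjoint Q & nondarts].
  by rewrite disjoint_subset; apply/subsetP=> d /Qd h; rewrite !inE negbK.
rewrite -cardsUI disjoint_setI0 // cards0 addn0.
rewrite -(card_in_imset (f := porbit s)) ?subset_leq_card //.
  by apply/subsetP=> o /imsetP [d _ ->]; apply: imset_f.
move=> d d' /setUP dQ /setUP d'Q E.
have m : d \in porbit s d' by rewrite -E porbit_id.
case: d'Q => [d'Q|]; last by rewrite inE => n; apply: pf.
case: dQ => [dQ|]; first exact: Qi.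
by rewrite inE (pd _ _ m) (Qd _ d'Q).
Qed.

Lemma porbit_sigma v u w : e v u -> e v w -> (v, w) \in porbit sigma (v, u).
Proof.
move=> vu vw; have [_ h] := rs v; have /iter_findex <- := h _ _ vu vw.
elim: (findex _ _ _) => [|n IH]; first exact: porbit_id.
have := forall_inP (porbit_stable sigma (v, u)) _ IH.
by rewrite permE.
Qed.

Lemma card_darts_alpha :
  (#|dart e| + #|nondarts|.*2 <= #|porbits alpha|.*2)%N.
Proof.
(* One dart of each edge, chosen by orienting the edge along [enum_rank]. *)
pose Q := [set d : T * T | e d.1 d.2 && (enum_rank d.1 < enum_rank d.2)].
have lQ : #|Q| + #|nondarts| <= #|porbits alpha|.
  apply: card_porbits_darts; [exact: dart_alpha|exact: alpha_fix| |].
    by move=> d; rewrite inE => /andP [].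
  move=> [x y] [z t]; rewrite !inE /= => /andP [xy rxy] /andP [zt rzt] m.
  have : (x, y) \in [set (z, t); (t, z)].
    apply: (stable_porbit _ m); last by rewrite !inE eqxx.
    apply/forall_inP=> d; rewrite !inE => /orP [] /eqP ->; rewrite permE /= ?zt ?eqxx ?orbT //.
    by rewrite es zt eqxx.
  rewrite !inE => /orP [/eqP //|/eqP [E1 E2]]; subst.
  by move: rxy rzt; lia.
have lD : #|dart e| <= #|Q| + #|Q|.
  have E : #|[set (d.2, d.1) | d in Q]| = #|Q|.
    by apply: card_imset => [] [? ?] [? ?] /= [-> ->].
  rewrite -{1}E -cardsUI; apply: leq_trans (leq_addr _ _).
  apply/subset_leq_card/subsetP => [] [x y]; rewrite -topredE /= /dart /= => xy.
  rewrite !inE /=; have [/= ltxy|/= ltyx|/ord_inj/enum_rank_inj Exy] := ltngtP (enum_rank x) (enum_rank y).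
  - by rewrite xy orbT.
  - apply/orP; left; apply/imsetP; exists (y, x) => //.
    by rewrite inE /= es xy.
  - by rewrite Exy ei in xy.
by move: lQ lD; lia.
Qed.

Lemma card_phi : nfaces e rot + #|nondarts| <= #|porbits phi|.
Proof.
have fi : injective (face_step e rot).
  by move=> d d'; rewrite -!phiE => /perm_inj.
rewrite /nfaces /n_comp_mem -[#|predI _ _|]cardsE.
apply: card_porbits_darts; [exact: dart_phi|exact: phi_fix| |].
  by move=> d; rewrite !inE => /andP [].
move=> d d'; rewrite !inE => /andP [/eqP r1 _] /andP [/eqP r2 _] /porbitP [i E].
rewrite -r1 -r2; apply/(rootP (fconnect_sym fi)); rewrite (fconnect_sym fi).
rewrite E permX (eq_iter phiE); exact: fconnect_iter.
Qed.

Hypothesis adj : forall x, exists y, e x y.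

Lemma card_sigma : #|T| + #|nondarts| <= #|porbits sigma|.
Proof.
pose nb x := odflt x [pick y | e x y].
have nbP x : e x (nb x).
  by rewrite /nb; case: pickP => //= h; have [y] := adj x; rewrite h.
rewrite -cardsT -(card_imset (f := fun x => (x, nb x))); last by move=> x y [].
apply: card_porbits_darts; [exact: dart_sigma|exact: sigma_fix| |].
  by move=> d /imsetP [x _ ->]; apply: nbP.
move=> d d' /imsetP [x _ ->] /imsetP [y _ ->] /porbitP [i E].
suff -> : x = y by [].
rewrite -[x]/((x, nb x).1) E; elim: i {E} => [|i IH]; first by rewrite expg0 perm1.
by rewrite expgSr permM permE.
Qed.

Hypothesis planar : 2 * #|T| + 2 * nfaces e rot = #|dart e| + 4.

(** Euler's formula in terms of orbits. The left side is the bound of the genus inequality for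
    [#|nondarts|.+1] points, so any surgery that gains orbits must disconnect the map. *)
Lemma planar_porbits :
  (#|{: T * T}| + (#|nondarts|.+1).*2
     <= #|porbits alpha| + #|porbits sigma| + #|porbits phi|)%N.
Proof.
have := card_sigma; have := card_phi; have := card_darts_alpha.
have : #|{: T * T}| = #|dart e| + #|nondarts|.
  by rewrite -(cardC (dart e)) /nondarts cardsE.
by move: planar; lia.
Qed.

End Rotation.

(** * From outer faces to non-crossing chords *)

Section Crossing.
Variables (T : finType) (e : rel T) (rot : T -> {perm T}).
Hypotheses (es : symmetric e) (ei : irreflexive e) (rs : rotation_system e rot).
Hypothesis ec : connected_graph e.
Hypothesis eb : bridgeless e.
Hypothesis adj : forall x, exists y, e x y.
Hypothesis planar : 2 * #|T| + 2 * nfaces e rot = #|dart e| + 4.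
Local Notation sigma := (sigma rot).
Local Notation alpha := (alpha es).
Local Notation phi := (phi rot es).
Local Notation nondarts := (nondarts e).

(** A [sigma]-stable set contains all darts at a vertex or none, and the edges of the connected
    relation [r] carry this from one vertex to the next. *)
Lemma stable_full (r : rel T) (A : {set T * T}) d :
  (forall x y, connect r x y) ->
  (forall x y, r x y -> e x y /\ ((x, y) \in A -> (y, x) \in A)) ->
  nondarts \subset A -> stable sigma A -> d \in A -> dart e d -> A = setT.
Proof.
move=> rc rA /subsetP ndA sA; case: d => v0 u0 dA d_e.
have full v u : (v, u) \in A -> e v u -> forall w, e v w -> (v, w) \in A.
  by move=> vA vu w vw; apply: (stable_porbit sA _ vA); apply: (porbit_sigma rs).
suff all v : forall w, e v w -> (v, w) \in A.
  apply/setP=> [] [v w]; rewrite inE; have [vw|vw] := boolP (e v w); first exact: all.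
  by apply: ndA; rewrite inE.
have /connectP [p pp ->] := rc v0 v.
have : forall w, e v0 w -> (v0, w) \in A by exact: full dA d_e.
elim: p v0 pp {dA d_e} => //= x p IH v0 /andP [v0x pp] h; apply: IH => // w xw.
have [e0 A0] := rA _ _ v0x.
by apply: (full x v0) => //; [exact/A0/h|rewrite es].
Qed.

Lemma connect_remove_edge a c x y : e a c -> connect (remove_edge e a c) x y.
Proof.
move=> ac; have /connect_sub : subrel e (connect (remove_edge e a c)).
  move=> u v uv; case h : (((u == a) && (v == c)) || ((u == c) && (v == a))).
    have rsym : connect_sym (remove_edge e a c).
      apply: sym_connect_sym => s t; rewrite /remove_edge es.
      by rewrite orbC ![(_ == _) && (s == _)]andbC.
    by case/orP: h => /andP [/eqP -> /eqP ->]; [|rewrite rsym]; apply: eb.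
  by apply: connect1; rewrite /remove_edge uv h.
by apply; apply: ec.
Qed.

Lemma not_generates s t d :
  #|{: T * T}| + (#|nondarts|.+1).*2
    < #|porbits s| + #|porbits t| + #|porbits (s * t)%g| ->
  ~ generates s t (d |: nondarts).
Proof.
move=> lt /card_porbits_generates; rewrite leqNgt => /negP; apply.
by apply: leq_ltn_trans lt; rewrite leq_add2l leq_double cardsU1; case: (d \notin _).
Qed.

(* Deleting an edge with the same face on both sides would create a face without
   disconnecting the graph. *)
Lemma edge_two_faces a c : e a c -> (a, c) \notin porbit phi (c, a).
Proof.
move=> ac; apply/negP=> m.
have ne : ((a, c) != (c, a)).
  by apply: contraTneq ac => - [-> _]; rewrite ei.
(* Multiplying by the transposition of the two darts of [ac] makes both fixed points of the edge
   permutation, which deletes the edge. It also splits the face containing both darts. *)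
have := porbits_mul_tperm alpha (a, c) (c, a).
have := porbits_mul_tperm phi (a, c) (c, a).
rewrite /= m ne /=.
have -> : (a, c) \in porbit alpha (c, a).
  have := mem_porbit alpha 1 (c, a); rewrite expg1 permE /= es ac //.
set t := tperm _ _; rewrite !addn0 !addn1 => c1 c2.
apply: (@not_generates (t * alpha)%g sigma (a, c)).
  rewrite -mulgA c1 c2 addSn addnS ltnS addSn leqW //.
  exact: planar_porbits es ei rs adj planar.
apply/forallP=> A; apply/implyP=> /and3P [].
rewrite subUset sub1set => /andP [acA ndA] tA sA; apply/eqP.
apply: (stable_full (fun x y => connect_remove_edge x y ac)) acA ac => // x y.
case/andP=> xy; rewrite !negb_or -!xpair_eqE => /andP [n1 n2]; split=> // xyA.
have := forall_inP tA _ xyA; rewrite permM tpermD 1?eq_sym //.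
by rewrite permE /= xy.
Qed.

(* The darts [xa], [xb], [xc], [xd] occur in this order on a face. If the face of [(a, c)]
   is another one, multiplying by the transpositions [t1], [t2] cuts the vertices [a] and [c]
   at the corners [xa], [xc] and at the corners next to the edge [ac]. This produces two more
   vertices and as many faces, while the edge [bd] keeps the map connected. *)
Lemma no_crossing_face a b c d (xa xb xc xd : T * T) i j k l :
  xa.1 = a -> xb.1 = b -> xc.1 = c -> xd.1 = d ->
  dart e xa -> dart e xb -> dart e xc -> dart e xd ->
  a != c -> b != a -> b != c -> d != a -> d != c ->
  0 < j -> 0 < k -> 0 < l ->
  iter i phi xa = xb -> iter j phi xb = xc -> iter k phi xc = xd -> iter l phi xd = xa ->
  (forall n, 0 < n < i + j -> iter n phi xa \notin [:: xa; xc]) ->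
  (forall n, 0 < n < k + l -> iter n phi xc \notin [:: xa; xc]) ->
  e a c -> e b d -> (a, c) \in porbit phi xa.
Proof.
move=> ta tb tc td da db dc dd nac nba nbc nda ndc j0 k0 l0 xaE xbE xcE xdE av1 av2 ac bd.
apply/negPn/negP=> nf.
pose ra := (a, c); pose rc := phi ra; pose t1 := tperm xa ra; pose t2 := tperm xc rc.
have trc : rc.1 = c by rewrite /rc phiE // /face_step /= ac.
have drc : dart e rc by rewrite dart_phi.
have nra : xa != ra by apply: contraNneq nf => E; rewrite -/ra -E porbit_id.
have ntail x y : x.1 != y.1 -> x != y by move=> h; apply: contraNneq h => ->.
have n1 : xa != xc by rewrite ntail // ta tc.
have n2 : xa != rc by rewrite ntail // ta trc.
have n3 : ra != xc by rewrite ntail // tc.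
have n4 : ra != rc by rewrite ntail // trc.
pose O := porbit phi xa.
have raO : ra \notin O by [].
have rcO : rc \notin O.
  apply: contra raO => h; apply: (stable_porbit (porbit_stable phi xa)) h.
  by rewrite porbit_sym (mem_porbit phi 1).
have sO : stable phi O := porbit_stable phi xa.
have itO n x : x \in O -> iter n phi x \in O.
  by move=> xO; elim: n => // n IH; apply: (forall_inP sO).
have xaO : xa \in O := porbit_id phi xa.
have xbO : xb \in O by rewrite -xaE itO.
have xcO : xc \in O by rewrite -xbE itO.
have xdO : xd \in O by rewrite -xcE itO.
have neO x y : x \in O -> y \notin O -> y != x.
  by move=> xO; apply: contraNneq => ->.
have av1' n : n.+1 < i + j -> (iter n.+1 phi xa != xa) && (iter n.+1 phi xa != xc).
  by move=> h; have := av1 n.+1 h; rewrite !inE negb_or.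
have av2' n : n.+1 < k + l -> (iter n.+1 phi xc != xa) && (iter n.+1 phi xc != xc).
  by move=> h; have := av2 n.+1 h; rewrite !inE negb_or.
have xcE' : iter (i + j) phi xa = xc by rewrite addnC iterD xaE.
pose sigma' := (sigma * t1 * t2)%g.
have phi1E x : x \in O -> phi x != xa -> (phi * t1)%g x = phi x.
  move=> xO h; rewrite permM tpermD //; first by rewrite eq_sym.
  by rewrite neO // (forall_inP sO).
have phi'E x : x \in O -> phi x != xa -> phi x != xc -> (phi * t1 * t2)%g x = phi x.
  move=> xO h1 h2; rewrite permM phi1E // tpermD //; first by rewrite eq_sym.
  by rewrite neO // (forall_inP sO).
have e1 : #|porbits (sigma * t1)| = #|porbits sigma|.+1.
  have := card_porbits_mulr_tperm sigma xa ra; rewrite -/t1 nra /=.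
  have -> : xa \in porbit sigma ra.
    by rewrite (surjective_pairing xa) ta; apply: (porbit_sigma rs) => //; rewrite -ta.
  by rewrite addn0 addn1.
have sfst v : stable sigma [set x : T * T | x.1 == v].
  by apply/forall_inP=> x; rewrite !inE permE.
have e2 : #|porbits sigma'| = #|porbits sigma|.+2.
  have := card_porbits_mulr_tperm (sigma * t1)%g xc rc; rewrite -/t2 -/sigma' e1.
  have -> : xc != rc by rewrite eq_sym neO.
  have -> : xc \in porbit (sigma * t1)%g rc.
    apply: (porbit_agree (sfst c)); rewrite ?inE ?trc //.
      move=> x; rewrite inE => /eqP xc1; rewrite permM tpermD //.
        by rewrite ntail // permE /= xc1 ta.
      by rewrite ntail // permE /= xc1.
    rewrite (surjective_pairing xc) tc (surjective_pairing rc) trc.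
    by apply: (porbit_sigma rs); [rewrite -trc|rewrite -tc].
  by rewrite addn0 addn1.
have e3 : #|porbits (phi * t1)|.+1 = #|porbits phi|.
  have := card_porbits_mulr_tperm phi xa ra; rewrite -/t1 nra.
  have -> : xa \notin porbit phi ra by rewrite porbit_sym.
  by rewrite !addnS !addn0 => - [].
have e4 : #|porbits (phi * t1 * t2)| = #|porbits phi|.
  have := card_porbits_mulr_tperm (phi * t1)%g xc rc; rewrite -/t2.
  have -> : xc != rc by rewrite eq_sym neO.
  have -> : xc \in porbit (phi * t1)%g rc.
    pose B := porbit (phi * t1)%g rc; have sB : stable (phi * t1)%g B := porbit_stable _ _.
    have : xa \in B.
      have : ra \in B.
        rewrite /B porbit_sym; have <- : (phi * t1)%g ra = rc.
          by rewrite permM -/rc tpermD.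
        exact: (mem_porbit (phi * t1)%g 1).
      apply: (stable_porbit sB).
      (* A second multiplication by [t1] restores [phi], which has one orbit more. It is therefore a
         split, so [xa] and [ra] lie on one orbit of [phi * t1]. *)
      have := card_porbits_mulr_tperm (phi * t1)%g xa ra; rewrite nra -/t1.
      have -> : (phi * t1 * t1 = phi)%g by rewrite -mulgA tperm2 mulg1.
      rewrite -e3; case: (xa \in _) => //=.
      by move/eqP; rewrite addSnnS eqn_add2l.
    rewrite -/B -xcE' => /(stable_iter sB); apply=> m m_lt.
    have [E|h] := eqVneq m.+1 (i + j).
      by rewrite phi1E ?itO //= -/(iter m.+1 _ _) E xcE' eq_sym.
    by rewrite phi1E ?itO //; have := av1' m; rewrite ltn_neqAle h m_lt => /(_ isT) /andP [].
  by rewrite addn0 addn1 -e3.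
have phi'mul : (alpha * sigma')%g = (phi * t1 * t2)%g by rewrite /sigma' !mulgA.
apply: (@not_generates alpha sigma' xa).
  have := planar_porbits es ei rs adj planar.
  rewrite phi'mul e2 e4 addnS addSn addnS addSn => h; exact: leqW.
apply/forallP=> A; apply/implyP=> /and3P [].
rewrite subUset sub1set => /andP [xaA ndA] aA s'A; apply/eqP.
have p'A : stable (phi * t1 * t2)%g A by rewrite -phi'mul stable_mul.
(* The new face permutation agrees with [phi] on the arc from [xa] through [xb]; instead of reaching
   [xc] it then continues to [rc]. *)
have arc1 n : n < i + j -> iter n phi xa \in A.
  move=> h; apply: (stable_iter p'A) => // m mn.
  have /andP [? ?] := av1' m (leq_ltn_trans mn h).
  by rewrite phi'E ?itO.
have xbA : xb \in A by rewrite -xaE arc1 // -[X in X < _]addn0 ltn_add2l.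
have ij0 : 0 < i + j by rewrite addn_gt0 j0 orbT.
have rcA : rc \in A.
  have := forall_inP p'A _ (arc1 (i + j).-1 _); rewrite prednK // => /(_ (leqnn _)).
  rewrite permM permM -[phi (iter _ _ _)]/(iter (i + j).-1.+1 phi xa).
  rewrite prednK // xcE'.
  by rewrite [t1 _]tpermD // tpermL.
have s'fst v x : v != a -> v != c -> x.1 = v -> sigma x = sigma' x.
  move=> va vc tx; have ts : (sigma x).1 = v by rewrite permE.
  by rewrite !permM !tpermD // ntail // ?ta ?tc ?trc ?ts // eq_sym.
(* The vertices [b] and [d] are not cut, so the edge [bd] leads from the first arc to the second. *)
have bdA : (b, d) \in A.
  apply: (stable_porbit s'A _ xbA); apply: (porbit_agree (sfst b)).
  - by move=> x; rewrite inE => /eqP; apply: s'fst.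
  - by rewrite inE tb.
  - by rewrite (surjective_pairing xb) tb; apply: (porbit_sigma rs) => //; rewrite -tb.
have dbA : (d, b) \in A.
  by have := forall_inP aA _ bdA; rewrite permE /= bd.
have xdA : xd \in A.
  apply: (stable_porbit s'A _ dbA); apply: (porbit_agree (sfst d)).
  - by move=> x; rewrite inE => /eqP; apply: s'fst.
  - by rewrite inE.
  - rewrite (surjective_pairing xd) td; apply: (porbit_sigma rs).
      by rewrite es.
    by rewrite -td.
have arc2 n : n < l -> iter n phi xd \in A.
  move=> h; apply: (stable_iter p'A) => // m mn.
  have := av2' (m + k); rewrite -addSn addnC ltn_add2l => /(_ (leq_ltn_trans mn h)).
  rewrite addnC iterD xcE => /andP [? ?].
  by rewrite phi'E ?itO.
have raA : ra \in A.
  have := forall_inP p'A _ (arc2 l.-1 _); rewrite prednK // => /(_ (leqnn _)).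
  rewrite permM permM -[phi (iter _ _ _)]/(iter l.-1.+1 phi xd).
  rewrite prednK // xdE tpermL tpermD // eq_sym //.
have xcA : xc \in A.
  have := forall_inP p'A _ raA.
  by rewrite permM permM -/rc [tperm xa ra rc]tpermD // tpermR.
(* All four corners now lie in [A], so [t1] and [t2] preserve [A]: the cuts separate nothing, and
   connectedness of the original graph applies. *)
have sA : stable sigma A.
  apply/forall_inP=> x /(forall_inP s'A).
  by rewrite !permM !mem_tperm.
apply: (stable_full ec _ ndA sA xaA da) => x y xy; split=> //.
by move/(forall_inP aA); rewrite permE /= xy.
Qed.

End Crossing.

(* An order of the vertices in which no two edges cross: the vertices can be placed on a
   circle in this order with all edges drawn as pairwise non-crossing chords. *)
Definition noncrossing (T : finType) (e : rel T) (p : T -> nat) : Prop :=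
  injective p /\
  forall a b c d, p a < p b -> p b < p c -> p c < p d -> e a c -> e b d -> False.

Lemma outerplanar_noncrossing (T : finType) (e : rel T) :
  simple_graph e -> connected_graph e -> bridgeless e -> outerplanar e ->
  exists p : T -> nat, noncrossing e p.
Proof.
move=> [es ei] ec eb [rot [[rs planar] [d0 [dart0 cover]]]].
have adj x : exists y, e x y by have [y [xy _]] := cover x; exists y.
pose f := phi rot es.
have fE : f =1 face_step e rot := phiE es rs.
pose nb x := odflt x [pick y | e x y && fconnect f d0 (x, y)].
have nbP x : e x (nb x) /\ fconnect f d0 (x, nb x).
  rewrite /nb; case: pickP => [y /andP [] //|h]; have [y [xy c]] := cover x.
  by have := h y; rewrite (eq_fconnect fE) c andbT => /negP [].
(* A vertex may occur several times on the outer face; [p x] is the position of one chosen dart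
   [D x] at [x]. The default value in [nb] never occurs. *)
pose D x := (x, nb x); pose p x := findex f d0 (D x).
have fi : injective f by apply: perm_inj.
have itp x : iter (p x) f d0 = D x by apply: iter_findex; have [] := nbP x.
have ltp x : p x < fingraph.order f d0 by apply: findex_max; have [] := nbP x.
have pinj : injective p by move=> x y E; have := itp x; rewrite E itp => - [].
exists p; split=> // a b c d ab bc cd ac bd.
have itO := iter_order fi d0.
set m := fingraph.order f d0 in itO ltp.
have dD x : dart e (D x) by have [] := nbP x.
have ne x y : p x < p y -> (x != y) && (y != x).
  by move=> h; apply/andP; split; apply: contraTneq h => ->; rewrite ltnn.
have itm x y : p x < p y -> iter (p y - p x) f (D x) = D y.
  by move=> h; rewrite -itp -iterD subnK ?itp // ltnW.
(* Going back from a later to an earlier position means completing the turn around the face of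
   length [m]. *)
have itw x y : p x < p y -> iter (m - p y + p x) f (D y) = D x.
  move=> h; rewrite -(itp y) -iterD addnAC subnK; last exact/ltnW/ltp.
  by rewrite addnC iterD itO itp.
have avoid x n : iter n f d0 = D x -> n < m -> n = p x.
  by move=> E h; rewrite /p -E findex_iter.
have av1 n : 0 < n < (p b - p a) + (p c - p b) -> iter n f (D a) \notin [:: D a; D c].
  move=> h; rewrite -[X in iter n f X]itp -iterD !inE negb_or; have := ltp c.
  by move=> ltc; apply/andP; split; apply/eqP=> /avoid; lia.
have av2 n : 0 < n < (p d - p c) + (m - p d + p a) -> iter n f (D c) \notin [:: D a; D c].
  move=> h; rewrite -[X in iter n f X]itp -iterD !inE negb_or; have := (ltp c, ltp d).
  case=> ltc ltd; have [lt|le] := ltnP (n + p c) m.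
    by apply/andP; split; apply/eqP=> /avoid; lia.
  rewrite -(subnK le) iterD itO.
  by apply/andP; split; apply/eqP=> /avoid; lia.
have [/andP [? ?] /andP [? ?]] := (ne _ _ ab, ne _ _ bc).
have [/andP [? ?] /andP [? ?]] := (ne _ _ cd, ne _ _ (ltn_trans ab bc)).
have [/andP [? ?] /andP [? ?]] := (ne _ _ (ltn_trans bc cd), ne _ _ (ltn_trans ab (ltn_trans bc cd))).
have pos x y : p x < p y -> 0 < p y - p x by rewrite subn_gt0.
have posw x y : 0 < m - p x + p y by rewrite addn_gt0 subn_gt0 ltp.
have ad := ltn_trans ab (ltn_trans bc cd).
(* Used twice, with the circle read from [a] and from [c]: both darts of [ac] lie on the outer face,
   against [edge_two_faces]. *)
have crossing := @no_crossing_face T e rot es ei rs ec adj planar.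
have c1 : (a, c) \in porbit f (D a).
  apply: (crossing a b c d (D a) (D b) (D c) (D d) _ _ _ _ (erefl a) (erefl b) (erefl c)
    (erefl d) (dD a) (dD b) (dD c) (dD d) _ _ _ _ _ (pos _ _ bc) (pos _ _ cd) (posw d a)
    (itm _ _ ab) (itm _ _ bc) (itm _ _ cd) (itw _ _ ad) av1 av2 ac bd) => //.
have c2 : (c, a) \in porbit f (D c).
  apply: (crossing c d a b (D c) (D d) (D a) (D b) _ _ _ _ (erefl c) (erefl d) (erefl a)
    (erefl b) (dD c) (dD d) (dD a) (dD b) _ _ _ _ _ (posw d a) (pos _ _ ab) (pos _ _ bc)
    (itm _ _ cd) (itw _ _ ad) (itm _ _ ab) (itm _ _ bc)) => //; rewrite 1?es //.
  - by move=> n /av2; rewrite !inE orbC.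
  - by move=> n /av1; rewrite !inE orbC.
have := edge_two_faces es ei rs ec eb adj planar ac; rewrite -/f.
rewrite -eq_porbit_mem in c1; rewrite -eq_porbit_mem in c2.
rewrite -eq_porbit_mem (eqP c1) (eqP c2) eq_porbit_mem.
by rewrite -(itm a c) ?(ltn_trans ab bc) // porbit_sym -permX mem_porbit.
Qed.

(** * Chord diagrams *)

Section Balls.
Variables (T : finType) (e : rel T).

Definition near1 : rel T := fun x y => (x == y) || e x y.
Definition near2 : rel T := fun x y => [exists w, near1 x w && near1 w y].
Definition near3 : rel T := fun x y => [exists w, near1 x w && near2 w y].

Lemma near1_refl x : near1 x x. Proof. by rewrite /near1 eqxx. Qed.

Lemma near1_edge x y : e x y -> near1 x y.
Proof. by rewrite /near1 orbC => ->. Qed.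

Lemma near2I x w y : near1 x w -> near1 w y -> near2 x y.
Proof. by move=> xw wy; apply/existsP; exists w; rewrite xw. Qed.

Lemma near12 x y : near1 x y -> near2 x y.
Proof. exact/near2I/near1_refl. Qed.

Lemma near3P x y :
  reflect (exists w1 w2, [/\ near1 x w1, near1 w1 w2 & near1 w2 y]) (near3 x y).
Proof.
apply: (iffP existsP) => [[w1 /andP [h1 /existsP [w2 /andP [h2 h3]]]]|[w1 [w2 [h1 h2 h3]]]].
  by exists w1, w2.
by exists w1; rewrite h1 (near2I h2).
Qed.

Lemma dist_le_near3 x y : dist_le e x y 3 -> near3 x y.
Proof.
case=> p [/andP [pp /eqP <-]] {y}; case: p pp => [|w1 [|w2 [|w3 [|//]]]] /= pp _;
  apply/near3P.
- by exists x, x; rewrite near1_refl.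
- by exists x, x; case/andP: pp => h _; rewrite /near1 h eqxx orbT.
- by exists x, w1; case/and3P: pp => h1 h2 _; rewrite /near1 h1 h2 eqxx !orbT.
- by exists w1, w2; case/and4P: pp => h1 h2 h3 _; rewrite /near1 h1 h2 h3 !orbT.
Qed.

Hypothesis es : symmetric e.

Lemma near1_sym : symmetric near1.
Proof. by move=> x y; rewrite /near1 eq_sym es. Qed.

Lemma near2_sym : symmetric near2.
Proof.
suff h x y : near2 x y -> near2 y x by move=> x y; apply/idP/idP; apply: h.
by case/existsP=> w /andP [xw wy]; apply: (near2I (w := w)); rewrite near1_sym.
Qed.

(** A walk of at most three steps between vertices separated by [P] must meet the cut [C]. As its
    ends are not in [C], it does so at one of its two inner vertices. *)
Lemma near3_cut (P C : pred T) y t :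
  (forall x z, e x z -> ~~ C x -> ~~ C z -> P x = P z) ->
  near3 y t -> ~~ C y -> ~~ C t -> P y != P t ->
  exists2 c, C c & (near1 y c && near2 c t) || (near2 y c && near1 c t).
Proof.
move=> cut /near3P [w1 [w2 [h1 h2 h3]]] Cy Ct Pyt.
have [C1|C1] := boolP (C w1); first by exists w1; rewrite // h1 (near2I h2).
have [C2|C2] := boolP (C w2); first by exists w2; rewrite // h3 (near2I h1) // orbT.
have step x z : near1 x z -> ~~ C x -> ~~ C z -> P x = P z.
  by case/orP=> [/eqP ->|xz] //; apply: cut.
by case/eqP: Pyt; rewrite (step y w1) // (step w1 w2) // (step w2 t).
Qed.

End Balls.

Section Chords.
Variables (T : finType) (e : rel T) (p : T -> nat).
Hypotheses (es : symmetric e) (ei : irreflexive e) (nc : noncrossing e p).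

(* The side of the chord [ab] on which [x] lies: inside or outside the interval. *)
Definition side a b x := (p a < p x) (+) (p b < p x).

Lemma sideC a b x : side a b x = side b a x.
Proof. by rewrite /side addbC. Qed.

(** An edge joining the two sides of the chord [ab] would cross it. *)
Lemma side_edge a b x y : e a b -> e x y ->
  x != a -> x != b -> y != a -> y != b -> side a b x = side a b y.
Proof.
have [pi nx] := nc.
have ne u v : u != v -> p u <> p v by move=> /eqP h /pi.
wlog ab : a b / p a < p b => [wl eab exy ? ? ? ?|].
  have [ab|ba|/pi E] := ltngtP (p a) (p b); first exact: wl.
    by rewrite !(sideC a); apply: wl; rewrite // es.
  by rewrite E ei in eab.
wlog xy : x y / p x < p y => [wl eab exy ? ? ? ?|].
  have [xy|yx|/pi E] := ltngtP (p x) (p y); first exact: wl.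
    by symmetry; apply: wl; rewrite // es.
  by rewrite E ei in exy.
move=> eab exy /ne xa /ne xb /ne ya /ne yb.
have n1 : ~ [/\ p a < p x, p x < p b & p b < p y].
  by case=> h1 h2 h3; apply: (nx a x b y).
have n2 : ~ [/\ p x < p a, p a < p y & p y < p b].
  by case=> h1 h2 h3; apply: (nx x a y b).
rewrite /side; case: (ltnP (p a) (p x)) => h1; case: (ltnP (p b) (p x)) => h2;
case: (ltnP (p a) (p y)) => h3; case: (ltnP (p b) (p y)) => h4 //; try lia.
- by case: n1; split; lia.
- by case: n2; split; lia.
Qed.

Lemma side_path a b x q : e a b -> path e x q -> a \notin x :: q -> b \notin x :: q ->
  side a b x = side a b (last x q).
Proof.
move=> ab; elim: q x => //= y q IH x /andP [xy pq].
rewrite !(inE, negb_or) => /and3P [ax ay aq] /and3P [bx by_ bq].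
rewrite -IH // ?inE ?negb_or ?ay ?by_ //.
by apply: side_edge; rewrite // eq_sym.
Qed.

Lemma side_near3 a b y t : e a b -> near3 e y t -> y != a -> y != b -> t != a -> t != b ->
  side a b y != side a b t ->
  exists2 c, (c == a) || (c == b) &
    (near1 e y c && near2 e c t) || (near2 e y c && near1 e c t).
Proof.
move=> ab h ya yb ta tb ne.
apply: (near3_cut (P := side a b) (C := fun c => (c == a) || (c == b))) ne => //.
- by move=> x z xz; rewrite !negb_or => /andP [? ?] /andP [? ?]; apply: side_edge.
- by rewrite negb_or ya.
- by rewrite negb_or ta.
Qed.

(** * Polygons of edges and the vertices off them *)

Section Polygon.
Variables (c : seq T) (y : T).
Hypotheses (uc : uniq c) (cc : path.cycle e c) (lc : 2 < size c) (yc : y \notin c).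

Let M := (\max_(z : T) p z).+1.
(** The circular order restarted just after [y]: [M] exceeds every position, so the positions up to
    [p y] come last. *)
Let key x := if p y < p x then p x else p x + M.

Let ltM x : p x < M.
Proof. by rewrite ltnS (leq_bigmax (F := p)). Qed.

Let key_inj : injective key.
Proof.
move=> x z; rewrite /key; have [pi _] := nc; have := (ltM x, ltM z) => - [? ?].
by case: ifP; case: ifP => ? ? E; apply: pi; lia.
Qed.

Let key_sides a s t b : p y <> p a -> p y <> p s -> p y <> p t -> p y <> p b ->
  key a < key s -> key s < key t -> key t < key b -> side a t s != side a t b.
Proof.
rewrite /key /side; have := (ltM a, ltM s, ltM t, ltM b) => - [[[? ?] ?] ?] ? ? ? ?.
case: (ltnP (p y) (p a)) => ?; case: (ltnP (p y) (p s)) => ?; case: (ltnP (p y) (p t)) => ?;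
case: (ltnP (p y) (p b)) => ?; lia.
Qed.

Let key_side a t b : p y <> p a -> p y <> p t -> p y <> p b ->
  key a < key t -> key t < key b -> side a b y != side a b t.
Proof.
rewrite /key /side; have := (ltM a, ltM t, ltM b) => - [[? ?] ?] ? ? ?.
case: (ltnP (p y) (p a)) => ?; case: (ltnP (p y) (p t)) => ?;
case: (ltnP (p y) (p b)) => ?; lia.
Qed.

(* Going around the circle from [y], the first and the last vertex of the polygon must be
   consecutive on it: otherwise the polygon would have to cross one of its own edges. *)
Lemma polygon_side :
  exists i a b r, rot i c = [:: a, b & r] /\ {in r, forall t, side a b y != side a b t}.
Proof.
have [pi _] := nc.
have yP z : z \in c -> p y <> p z by move=> zc /pi E; move: yc; rewrite E zc.
have [z0 z0c] : exists z, z \in c by case: (c) lc => // z ? _; exists z; rewrite mem_head.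
have [a ac amin] : exists2 a, a \in c & forall x, x \in c -> key a <= key x.
  by case: (arg_minnP key z0c) => a; exists a.
have [b bc bmax] : exists2 b, b \in c & forall x, x \in c -> key x <= key b.
  by case: (arg_maxnP key z0c) => b; exists b.
have lt_key x z : x != z -> key x <= key z -> key x < key z.
  by move=> xz; rewrite leq_eqVlt => /orP [/eqP /key_inj /eqP|//]; rewrite (negbTE xz).
have [i r E] := rot_to ac.
have mE x : (x \in c) = (x \in a :: r) by rewrite -E mem_rot.
have ur : uniq (a :: r) by rewrite -E rot_uniq.
have cr : path.cycle e (a :: r) by rewrite -E rot_cycle.
have sr : size (a :: r) = size c by rewrite -E size_rot.
case: r => [|t0 r] in E mE ur cr sr *; first by move: lc; rewrite -sr.
case/lastP: r => [|r tl] in E mE ur cr sr *; first by move: lc; rewrite -sr.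
have t0c : t0 \in c by rewrite mE !inE eqxx orbT.
have tlc : tl \in c by rewrite mE !(inE, mem_rcons) eqxx !orbT.
have /and5P [ne0 nel ner ne' /and3P [ne'' ne3 ur']] :
   [&& a != t0, a != tl, a \notin r, t0 != tl & [&& t0 \notin r, tl \notin r & uniq r]].
  move: ur; rewrite /= !inE !mem_rcons !inE !negb_or rcons_uniq.
  by case/and3P=> /and3P [-> -> ->] /andP [-> ->] /andP [-> ->].
move: cr; rewrite /= rcons_path last_rcons => /andP [at0 /andP [pr tla]].
have inner t : t \in c -> t != a -> t != b -> side a b y != side a b t.
  move=> tc ta tb; apply: key_side; try exact: yP.
    by apply: lt_key; rewrite 1?eq_sym ?amin.
  by apply: lt_key; rewrite ?bmax.
have [Eb|nb0] := eqVneq b t0.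
  exists i, a, b, (rcons r tl); split; first by rewrite E Eb.
  move=> t tr; apply: inner.
  - by rewrite mE !inE tr !orbT.
  - by apply: contraTneq tr => ->; rewrite mem_rcons inE negb_or nel.
  - by apply: contraTneq tr => ->; rewrite Eb mem_rcons inE negb_or ne'.
have [Eb|nbl] := eqVneq b tl.
  have [j Ej] : exists j, rotr 1 (rot i c) = rot j c.
    have [le|lt] := leqP i (size c).
      by rewrite /rotr size_rot rot_add_mod ?leq_subr //; eexists.
    by rewrite rot_oversize ?(ltnW lt) //; eexists.
  exists j, b, a, (t0 :: r); split.
    by rewrite -Ej E Eb -rcons_cons -rcons_cons rotr1_rcons.
  move=> t tr; rewrite !(sideC b); apply: inner.
  - by rewrite mE !(inE, mem_rcons); move: tr; rewrite inE => /orP [] ->; rewrite ?orbT.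
  - by apply: contraTneq tr => ->; rewrite inE negb_or ne0.
  - by apply: contraTneq tr => ->; rewrite Eb inE negb_or eq_sym ne'.
(* If [t0] precedes [tl], the chord from [a] to [tl] separates [t0] from [b], but the polygon runs
   from [t0] to [b] avoiding [a] and [tl]. The other case is its mirror image. *)
exfalso.
have ba : b != a.
  apply: contraNneq ne0 => Eb; apply/eqP/key_inj/eqP.
  by rewrite eqn_leq amin //= -Eb bmax.
have br : b \in r.
  by move: bc; rewrite mE !(inE, mem_rcons) (negbTE ba) (negbTE nb0) (negbTE nbl).
case/splitPr: br => r1 r2 in E pr ner ne'' ne3 ur' *.
move: pr; rewrite rcons_cat cat_path => /= /and3P [p1 eb p2].
move: ner ne'' ne3; rewrite !(mem_cat, inE, negb_or).
case/and3P=> ar1 _ ar2 /and3P [t01 _ t02] /and3P [tl1 _ tl2].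
have ltb x : x \in c -> x != b -> key x < key b by move=> xc xb; rewrite lt_key // bmax.
have lta x : x \in c -> a != x -> key a < key x by move=> xc xa; rewrite lt_key // amin.
have [lt|gt|/key_inj E'] := ltngtP (key t0) (key tl).
- have /eqP[] : side a tl t0 != side a tl b.
    by apply: key_sides; rewrite ?lta ?ltb // 1?eq_sym //; apply: yP.
  rewrite -(last_rcons t0 r1 b); apply: side_path; rewrite 1?es ?rcons_path ?p1 //.
    by rewrite inE mem_rcons inE !negb_or ne0 eq_sym ba.
  by rewrite inE mem_rcons inE !negb_or eq_sym ne' eq_sym nbl.
- have /eqP[] : side a t0 tl != side a t0 b.
    by apply: key_sides; rewrite ?lta ?ltb // 1?eq_sym //; apply: yP.
  rewrite -(last_rcons b r2 tl); symmetry; apply: side_path => //.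
    by rewrite inE mem_rcons inE !negb_or eq_sym ba nel.
  by rewrite inE mem_rcons inE !negb_or eq_sym nb0 ne'.
- by rewrite E' eqxx in ne'.
Qed.

(** [y] lies behind one edge [ab] of the polygon, and an edge from [y] to any third polygon vertex
    would cross it. So [x] and [x'] are [a] and [b]. *)
Lemma polygon_common_neighbour x x' :
  x \in c -> x' \in c -> x != x' -> e y x -> e y x' -> e x x'.
Proof.
have [i [a [b [r [E S]]]]] := polygon_side.
have mE z : (z \in c) = (z \in [:: a, b & r]) by rewrite -E mem_rot.
have : uniq [:: a, b & r] by rewrite -E rot_uniq.
rewrite /= !(inE, negb_or) => /and3P [/andP [ab ar] br _].
have eab : e a b.
  have : path.cycle e [:: a, b & r] by rewrite -E rot_cycle.
  by rewrite /= => /andP [].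
have ya : y != a by apply: contraNneq yc => ->; rewrite mE mem_head.
have yb : y != b by apply: contraNneq yc => ->; rewrite mE !inE eqxx orbT.
have P z : z \in c -> e y z -> (z == a) || (z == b).
  rewrite mE !inE orbA => /orP [//|zr] yz; have := S z zr.
  have za : z != a by apply: contraNneq ar => <-.
  have zb : z != b by apply: contraNneq br => <-.
  by rewrite (side_edge eab yz) ?eqxx.
move=> /P xP /P x'P ne /xP /orP [] /eqP Ex /x'P /orP [] /eqP Ex'; subst => //.
- by rewrite eqxx in ne.
- by rewrite es.
- by rewrite eqxx in ne.
Qed.

End Polygon.
End Chords.

(** * Central edges *)

Section Domination.
Variables (T : finType) (e : rel T) (p : T -> nat).
Hypotheses (es : symmetric e) (ei : irreflexive e) (nc : noncrossing e p).
Hypothesis diam : forall x y, near3 e x y.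
Local Notation near1 := (near1 e).
Local Notation near2 := (near2 e).
Local Notation near3 := (near3 e).
Local Notation side := (side p).

Definition dominating (D : {set T}) := forall y, y \notin D -> exists2 d, d \in D & e y d.

Definition edge_centre a b := e a b /\ forall y, near2 a y || near2 b y.

(* Of three points on the same side of the chord [vw], each joined to [v] or to [w], the
   chord of the middle one separates the other two. *)
Lemma three_chords v w u1 u2 u3 x1 x2 x3 :
  uniq [:: v; u1; u2; u3] -> uniq [:: w; u1; u2; u3] ->
  (x1 == v) || (x1 == w) -> (x2 == v) || (x2 == w) -> (x3 == v) || (x3 == w) ->
  side v w u1 = side v w u2 -> side v w u1 = side v w u3 ->
  side x1 u1 u2 = side x1 u1 u3 -> side x2 u2 u1 = side x2 u2 u3 ->
  side x3 u3 u1 = side x3 u3 u2 -> False.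
Proof.
have [pi _] := nc.
have ne a b : a != b -> p a <> p b by move=> /eqP h /pi.
rewrite /= !inE !negb_or !andbT => /and3P [/and3P [/ne ? /ne ? /ne ?] /andP [/ne ? /ne ?] /ne ?].
case/and3P=> [/and3P [/ne ? /ne ? /ne ?] _ _].
move=> /orP [] /eqP -> /orP [] /eqP -> /orP [] /eqP ->; rewrite /side; lia.
Qed.


(** [A] is a minimal set of neighbours of the edge reaching everything not adjacent to it. By
    minimality each member has a private neighbour. Two private neighbours are joined by a short
    walk that avoids the chord of a third member, so three members would contradict
    [three_chords]. *)
Lemma edge_centre_dominating a b : edge_centre a b ->
  exists A : {set T}, [/\ #|A| <= 2, dominating ([set a; b] :|: A) &
    {in A, forall x, [&& x != a, x != b & e x a || e x b]}].
Proof.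
case=> ab cent; have sE a' b' x y := @side_edge T e p es ei nc a' b' x y.
pose N := [set x | [&& x != a, x != b & e x a || e x b]].
pose P (A : {set T}) := (A \subset N) &&
  [forall y, [|| near1 a y, near1 b y | [exists x in A, e x y]]].
have PN : P N.
  rewrite /P subxx /=; apply/forallP=> y; have := cent y.
  have [//|na] /= := boolP (near1 a y); have [//|nb] /= := boolP (near1 b y).
  have aux c : (c == a) || (c == b) -> near2 c y -> [exists x in N, e x y].
    move=> cab /existsP [x /andP [cx xy]].
    have cy : ~~ near1 c y by case/orP: cab => /eqP ->.
    have xa : x != a by apply: contraNneq na => <-.
    have xb : x != b by apply: contraNneq nb => <-.
    have ecx : e c x.
      by case/orP: cx => // /eqP E; move: cab; rewrite E (negbTE xa) (negbTE xb).
    have exy : e x y by case/orP: xy => // /eqP E; rewrite -E (near1_edge ecx) in cy.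
    apply/existsP; exists x; rewrite exy andbT inE xa xb /=.
    by case/orP: cab => /eqP <-; rewrite -(es c) ecx ?orbT.
  by case/orP; apply: aux; rewrite eqxx ?orbT.
have [A /minsetP [/andP [/subsetP AN /forallP dA] Amin] _] := minset_exists PN.
exists A; split; last by move=> x /AN; rewrite inE.
- rewrite leqNgt; apply/negP=> /card_gt2P [u1 [u2 [u3 [[u1A u2A u3A] [n12 n23 n31]]]]].
  have priv u : u \in A -> exists x, [/\ ~~ near1 a x, ~~ near1 b x, e u x &
      {in A, forall u', u' != u -> ~~ near1 u' x}].
    move=> uA; have : ~~ P (A :\ u).
      apply/negP=> PA; have := Amin _ PA (subD1set _ _).
      by move/setP/(_ u); rewrite !inE eqxx uA.
    rewrite /P negb_and => /orP [/subsetPn [x]|/forallPn [x]].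
      by rewrite !inE => /andP [_ /AN]; rewrite !inE => ->.
    case/norP=> nax /norP [nbx /existsPn h]; exists x.
    have := dA x; rewrite (negbTE nax) (negbTE nbx) /= => /existsP [u' /andP [u'A u'x]].
    have uu' : u' = u.
      by apply/eqP; apply: contraNT (h u') => ne; rewrite !inE ne u'A u'x.
    split=> //; first by rewrite -uu'.
    move=> w wA ne; have := h w; rewrite !inE ne wA /= => nwx.
    rewrite negb_or nwx andbT; apply: contraTneq (AN _ wA) => ->; rewrite inE !negb_and.
    have ex c : ~~ near1 c x -> ~~ e x c by rewrite es; apply/contra/near1_edge.
    by rewrite (negbTE (ex _ nax)) (negbTE (ex _ nbx)) !orbT.
  have [y1 [a1 b1 e1 o1]] := priv _ u1A; have [y2 [a2 b2 e2 o2]] := priv _ u2A.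
  have [y3 [a3 b3 e3 o3]] := priv _ u3A.
  have nbr u : u \in A -> [/\ u != a, u != b & exists2 w, (w == a) || (w == b) & e w u].
    move=> /AN; rewrite inE => /and3P [ua ub h]; split=> //.
    by case/orP: h => h; [exists a|exists b]; rewrite ?eqxx ?orbT // es.
  have far c y : ~~ near1 c y -> y != c.
    by apply: contraNneq => ->; apply: near1_refl.
  (* the path joining two private neighbours misses [c] and [d] *)
  have link c d u u' y y' : e c d -> e u y -> e u' y' -> u != c -> u != d -> u' != c -> u' != d ->
      ~~ near1 c y -> ~~ near1 d y -> ~~ near1 c y' -> ~~ near1 d y' -> side c d u = side c d u'.
    move=> cd uy uy' uc ud uc' ud' cy dy cy' dy'.
    have -> : side c d u = side c d y by apply: sE => //; apply: far.
    have -> : side c d u' = side c d y' by apply: sE => //; apply: far.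
    apply/eqP; apply: contraT => ne.
    have [||||x xcd h] := side_near3 es ei nc cd (diam y y') _ _ _ _ ne; try exact: far.
    by case/orP: xcd h => /eqP -> /orP [] /andP []; rewrite 1?(near1_sym es y) => h1 h2;
      move: cy dy cy' dy'; rewrite ?h1 ?h2.
  have [u1a u1b [x1 x1P ex1]] := nbr _ u1A; have [u2a u2b [x2 x2P ex2]] := nbr _ u2A.
  have [u3a u3b [x3 x3P ex3]] := nbr _ u3A.
  have xu x u : (x == a) || (x == b) -> u \in A -> u != x.
    by move=> /orP [] /eqP -> /nbr [].
  have xy x y : (x == a) || (x == b) -> ~~ near1 a y -> ~~ near1 b y -> ~~ near1 x y.
    by move=> /orP [] /eqP ->.
  have [n21 n32 n13] : [/\ u2 != u1, u3 != u2 & u1 != u3] by split; rewrite eq_sym.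
  apply: (@three_chords a b u1 u2 u3 x1 x2 x3) => //.
  - by rewrite /= !inE !negb_or ![a == _]eq_sym u1a u2a u3a n12 n23 eq_sym n31.
  - by rewrite /= !inE !negb_or ![b == _]eq_sym u1b u2b u3b n12 n23 eq_sym n31.
  - exact: link e1 e2 _ _ _ _ _ _ _ _.
  - exact: link e1 e3 _ _ _ _ _ _ _ _.
  - exact: (link _ _ _ _ _ _ ex1 e2 e3 (xu _ _ x1P u2A) n21 (xu _ _ x1P u3A) n31
      (xy _ _ x1P a2 b2) (o2 _ u1A n12) (xy _ _ x1P a3 b3) (o3 _ u1A n13)).
  - exact: (link _ _ _ _ _ _ ex2 e1 e3 (xu _ _ x2P u1A) n12 (xu _ _ x2P u3A) n32
      (xy _ _ x2P a1 b1) (o1 _ u2A n21) (xy _ _ x2P a3 b3) (o3 _ u2A n23)).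
  - exact: (link _ _ _ _ _ _ ex3 e1 e2 (xu _ _ x3P u1A) n13 (xu _ _ x3P u2A) n23
      (xy _ _ x3P a1 b1) (o1 _ u3A n31) (xy _ _ x3P a2 b2) (o2 _ u3A n32)).
- move=> y; rewrite !inE !negb_or => /andP [/andP [ya yb] yA].
  have := dA y; rewrite /near1 ![_ == y]eq_sym (negbTE ya) (negbTE yb) /=.
  case/or3P=> [h|h|/existsP [x /andP [xA xy]]]; [exists a|exists b|exists x];
    by rewrite ?inE ?eqxx ?xA ?orbT // es.
Qed.

End Domination.

(** * Induced cycles *)

Section Centre.
Variables (T : finType) (e : rel T) (p : T -> nat).
Hypotheses (es : symmetric e) (ei : irreflexive e) (nc : noncrossing e p).
Hypothesis diam : forall x y, near3 e x y.
Local Notation near1 := (near1 e).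
Local Notation near2 := (near2 e).
Local Notation near3 := (near3 e).
Local Notation side := (side p).
Local Notation far x y := (~~ near1 x y).

Lemma far_neq x y : far x y -> x != y.
Proof. by apply: contraNneq => ->; apply: near1_refl. Qed.

Lemma far_edge x y : far x y -> e x y = false.
Proof. by move=> h; apply: contraNF h; apply: near1_edge. Qed.

Lemma far_sym x y : far x y = far y x.
Proof. by rewrite near1_sym. Qed.

Lemma edge_neq x y : e x y -> x != y.
Proof. by apply: contraTneq => ->; rewrite ei. Qed.

Definition dominating_cycle c :=
  [/\ uniq c, path.cycle e c, (size c == 5) || (size c == 6) & dominating e [set x in c]].

Definition spanning_7cycle c :=
  [/\ uniq c, path.cycle e c, size c = 7 & forall x, x \in c].

(* A vertex off the polygon lies behind one of its edges, hence is adjacent to an end of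
   that edge as soon as some polygon vertex is at distance at least 2 from both ends. *)
Lemma polygon_dominating c : uniq c -> path.cycle e c -> 2 < size c ->
  (forall i a b r, rot i c = [:: a, b & r] -> exists t, [/\ t \in r, far a t & far b t]) ->
  dominating e [set x in c].
Proof.
move=> uc cc lc H y; rewrite inE => yc.
have [i [a [b [r [E S]]]]] := polygon_side es ei nc uc cc lc yc.
have [t [tr fa fb]] := H _ _ _ _ E.
have mE z : (z \in c) = (z \in [:: a, b & r]) by rewrite -E mem_rot.
have eab : e a b.
  have : path.cycle e [:: a, b & r] by rewrite -E rot_cycle.
  by rewrite /= => /andP [].
have ya : y != a by apply: contraNneq yc => ->; rewrite mE mem_head.
have yb : y != b by apply: contraNneq yc => ->; rewrite mE !inE eqxx orbT.
have ta : t != a by rewrite eq_sym far_neq.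
have tb : t != b by rewrite eq_sym far_neq.
have [d dab h] := side_near3 es ei nc eab (diam y t) ya yb ta tb (S t tr).
have fd : far d t by case/orP: dab => /eqP ->.
have yd : y != d by case/orP: dab => /eqP ->.
exists d; first by rewrite inE mE !inE orbA dab.
by case/orP: h => /andP []; [rewrite /near1 (negbTE yd)|rewrite (negbTE fd)].
Qed.

Lemma five_cycle_dominating a b c d f :
  e a b -> e b c -> e c d -> e d f -> e f a ->
  far a c -> far a d -> far b d -> far b f -> far c f -> dominating_cycle [:: a; b; c; d; f].
Proof.
move=> ab bc cd df fa ac ad bd bf cf.
have uc : uniq [:: a; b; c; d; f].
  rewrite /= !inE !negb_or !(far_neq ac, far_neq ad, far_neq bd, far_neq bf, far_neq cf).
  by rewrite !(edge_neq ab, edge_neq bc, edge_neq cd, edge_neq df) eq_sym edge_neq.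
have cc : path.cycle e [:: a; b; c; d; f] by rewrite /= ab bc cd df fa.
split=> //; apply: polygon_dominating => // i.
case: i => [|[|[|[|[|i]]]]] x y r; rewrite /rot /= => - [<- <- <-];
  [exists d|exists f|exists a|exists b|exists c|exists d];
  by split; rewrite ?inE ?eqxx ?orbT // far_sym.
Qed.

Lemma six_cycle_dominating a b c d f g :
  e a b -> e b c -> e c d -> e d f -> e f g -> e g a ->
  far a c -> far a d -> far a f -> far b d -> far b f -> far b g ->
  far c f -> far c g -> far d g -> dominating_cycle [:: a; b; c; d; f; g].
Proof.
move=> ab bc cd df fg ga ac ad af bd bf bg cf cg dg.
have uc : uniq [:: a; b; c; d; f; g].
  rewrite /= !inE !negb_or !(far_neq ac, far_neq ad, far_neq af, far_neq bd, far_neq bf,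
    far_neq bg, far_neq cf, far_neq cg, far_neq dg).
  rewrite !(edge_neq ab, edge_neq bc, edge_neq cd, edge_neq df, edge_neq fg).
  by rewrite eq_sym edge_neq.
have cc : path.cycle e [:: a; b; c; d; f; g] by rewrite /= ab bc cd df fg ga.
split=> //; apply: polygon_dominating => // i.
case: i => [|[|[|[|[|[|i]]]]]] x y r; rewrite /rot /= => - [<- <- <-];
  [exists d|exists f|exists g|exists a|exists b|exists c|exists d];
  by split; rewrite ?inE ?eqxx ?orbT // far_sym.
Qed.

(* In a chordless 7-cycle the vertex opposite to an edge is at distance 3 from both ends. *)
Lemma seven_cycle_spanning a b c d f g h :
  e a b -> e b c -> e c d -> e d f -> e f g -> e g h -> e h a ->
  far a c -> far b d -> far c f -> far d g -> far f h -> far g a -> far h b ->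
  far a d -> far b f -> far c g -> far d h -> far f a -> far g b -> far h c ->
  spanning_7cycle [:: a; b; c; d; f; g; h].
Proof.
move=> ab bc cd df fg gh ha ac bd cf dg fh ga hb ad bf cg dh fa gb hc.
set C := [:: a; b; c; d; f; g; h].
have uc : uniq C.
  rewrite /= !inE !negb_or !(far_neq ac, far_neq bd, far_neq cf, far_neq dg, far_neq fh,
    far_neq ad, far_neq bf, far_neq cg, far_neq dh, edge_neq ab, edge_neq bc,
    edge_neq cd, edge_neq df, edge_neq fg, edge_neq gh) /=.
  by rewrite !(eq_sym a) !(eq_sym b) !(eq_sym c) !(far_neq fa, far_neq ga, far_neq gb, far_neq hb,
    far_neq hc, edge_neq ha).
have cc : path.cycle e C by rewrite /= ab bc cd df fg gh ha.
(* A common neighbour off the polygon would force [x] and [x'] to be adjacent, so only common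
   neighbours in [C] have to be excluded. *)
have far2 x x' : x \in C -> x' \in C -> far x x' ->
    (forall w, w \in C -> e x w -> e w x' -> False) -> ~~ near2 x x'.
  move=> xC x'C fx no; apply/negP=> /existsP [w /andP [xw wx]].
  have xw' : e x w by case/orP: xw => // /eqP E; rewrite -E (negbTE fx) in wx.
  have wx' : e w x' by case/orP: wx => // /eqP E; rewrite -E (near1_edge xw') in fx.
  have [wC|wC] := boolP (w \in C); first exact: (no w).
  have := polygon_common_neighbour es ei nc uc cc isT wC xC x'C (far_neq fx).
  by rewrite es xw' wx' far_edge // => /(_ isT isT).
have E2 x y : far x y -> (e x y = false) * (e y x = false).
  by move=> h0; rewrite (es y) !far_edge.
have chords := (E2 _ _ ac, E2 _ _ bd, E2 _ _ cf, E2 _ _ dg, E2 _ _ fh, E2 _ _ ga, E2 _ _ hb,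
  E2 _ _ ad, E2 _ _ bf, E2 _ _ cg, E2 _ _ dh, E2 _ _ fa, E2 _ _ gb, E2 _ _ hc).
have dist3 x x' : x \in C -> x' \in C -> far x x' ->
    all (fun w => ~~ (e x w && e w x')) C -> ~~ near2 x x'.
  move=> xC x'C fx /allP no; apply: far2 => // w /no; case: (e x w) => //= /negbTE -> //.
have mC : (a \in C) * (b \in C) * (c \in C) * (d \in C) * (f \in C) * (g \in C) * (h \in C).
  by rewrite !inE !eqxx !orbT.
have ad2 : ~~ near2 a d by apply: dist3; rewrite ?mC //= !chords !ei ?andbF.
have bf2 : ~~ near2 b f by apply: dist3; rewrite ?mC //= !chords !ei ?andbF.
have cg2 : ~~ near2 c g by apply: dist3; rewrite ?mC //= !chords !ei ?andbF.
have dh2 : ~~ near2 d h by apply: dist3; rewrite ?mC //= !chords !ei ?andbF.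
have fa2 : ~~ near2 f a by apply: dist3; rewrite ?mC //= !chords !ei ?andbF.
have gb2 : ~~ near2 g b by apply: dist3; rewrite ?mC //= !chords !ei ?andbF.
have hc2 : ~~ near2 h c by apply: dist3; rewrite ?mC //= !chords !ei ?andbF.
split=> // y; apply: contraT => yc.
have [i [x [x' [r [E S]]]]] := polygon_side es ei nc uc cc isT yc.
have mE z : (z \in C) = (z \in [:: x, x' & r]) by rewrite -E mem_rot.
have exx : e x x'.
  have : path.cycle e [:: x, x' & r] by rewrite -E rot_cycle.
  by rewrite /= => /andP [].
have yx : y != x by apply: contraNneq yc => ->; rewrite mE mem_head.
have yx' : y != x' by apply: contraNneq yc => ->; rewrite mE !inE eqxx orbT.
(* A walk of length at most 3 from [y] to the opposite vertex [t] would pass through [x] or [x']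
   after at least one step, leaving at most two steps to [t]. *)
have opp t : t \in r -> ~~ near2 x t -> ~~ near2 x' t -> false.
  move=> tr xt xt'.
  have tx : t != x by apply: contraNneq xt => ->; rewrite near12 ?near1_refl.
  have tx' : t != x' by apply: contraNneq xt' => ->; rewrite near12 ?near1_refl.
  have [z zP hz] := side_near3 es ei nc exx (diam y t) yx yx' tx tx' (S t tr).
  have nz : ~~ near2 z t by case/orP: zP => /eqP ->.
  case/orP: hz => /andP [h1 h2]; first by rewrite h2 in nz.
  by rewrite near12 in nz.
have n2 := near2_sym es.
case: i E => [|[|[|[|[|[|[|i]]]]]]]; rewrite /rot /= => - [Ex Ex' Er]; subst;
  [apply: (opp f)|apply: (opp g)|apply: (opp h)|apply: (opp a)|apply: (opp b)|apply: (opp c)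
  |apply: (opp d)|apply: (opp f)]; by rewrite ?inE ?eqxx ?orbT // n2.
Qed.

End Centre.

(** * Existence of a centre *)

Section Trichotomy.
Variables (T : finType) (e : rel T) (p : T -> nat).
Hypotheses (es : symmetric e) (ei : irreflexive e) (nc : noncrossing e p).
Hypothesis diam : forall x y, near3 e x y.
Local Notation near1 := (near1 e).
Local Notation near2 := (near2 e).
Local Notation near3 := (near3 e).
Local Notation side := (side p).
Local Notation far x y := (~~ near1 x y).

Section FarComponent.
Variables v z : T.
Hypothesis vz : ~~ near2 v z.

Let K x := connect (fun x y => [&& e x y, far v x & far v y]) z x.

Let zK : K z. Proof. exact: connect0. Qed.

Let Kfar x : K x -> far v x.
Proof.
have fz : far v z by apply: contra vz; apply: near12.
case/connectP=> q; elim: q z fz => [|y q IH] s fs /=; first by move=> _ ->.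
by case/andP=> /and3P [_ _ fy]; apply: IH.
Qed.

Let Kext x y : K x -> e x y -> ~~ K y -> e v y.
Proof.
move=> Kx xy; apply: contraR => vy; apply: (connect_trans Kx (connect1 _)).
apply/and3P; split=> //; first exact: Kfar.
apply/norP; split=> //; apply: contraTneq (Kfar Kx) => ->.
by rewrite negbK near1_sym // near1_edge.
Qed.

Let Kside w x : e v w -> K x -> side v w x = side v w z.
Proof.
move=> vw /connectP [q]; have Kz := zK.
have sub s : K s -> v != s /\ w != s.
  by move=> /Kfar fs; split; [exact: far_neq fs|apply: contraNneq fs => <-; apply: near1_edge].
elim: q (z) Kz => [|y q IH] s Ks /=; first by move=> _ ->.
case/andP=> sy pq xE; have Ky : K y by apply: (connect_trans Ks); apply: connect1.
rewrite (IH y Ky pq xE); case/and3P: sy => sy _ _.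
have [? ?] := sub _ Ks; have [? ?] := sub _ Ky.
by apply: (side_edge es ei nc) => //; rewrite 1?es // eq_sym.
Qed.

Let att u := e v u && [exists x, K x && e x u].

Let att_side w u : e v w -> att u -> u != w -> side v w u = side v w z.
Proof.
move=> vw /andP [vu /existsP [x /andP [Kx xu]]] uw; rewrite -(Kside vw Kx).
have fx := Kfar Kx; apply: (side_edge es ei nc) => //; rewrite 1?es //.
- by rewrite eq_sym (edge_neq ei vu).
- by rewrite eq_sym (far_neq fx).
- by apply: contraNneq fx => ->; apply: near1_edge.
Qed.

(** The chord from [v] to one attachment has [K], hence the other two attachments, on one side. With
    the degenerate chord [vv], which separates nothing, [three_chords] applies. *)
Let att3 u1 u2 u3 : att u1 -> att u2 -> att u3 -> uniq [:: u1; u2; u3] -> False.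
Proof.
move=> A1 A2 A3 un; have [/andP [v1 _] /andP [v2 _] /andP [v3 _]] := And3 A1 A2 A3.
have [n12 n13 n23] : [/\ u1 != u2, u1 != u3 & u2 != u3].
  by move: un; rewrite /= !inE negb_or andbT => /andP [/andP [? ?] ?].
have uv : uniq [:: v; u1; u2; u3].
  by rewrite cons_uniq un !inE !negb_or !(edge_neq ei v1, edge_neq ei v2, edge_neq ei v3).
apply: (three_chords nc (x1 := v) (x2 := v) (x3 := v) uv uv); rewrite ?eqxx //.
- by rewrite /side !addbb.
- by rewrite /side !addbb.
- by rewrite !att_side // eq_sym.
- by rewrite !att_side // eq_sym.
- by rewrite !att_side // eq_sym.
Qed.

Lemma far_vertex_trichotomy :
  [\/ exists a b, edge_centre e a b, exists c, dominating_cycle e c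
    | exists c, spanning_7cycle e c].
Proof.
have fvz : far v z by apply: contra vz; apply: near12.
have [u attu] : exists u, att u.
  have /near3P [w1 [w2 [h1 h2 h3]]] := diam v z; exists w1.
  have f2 : far v w2 by apply: contra vz => h; apply: near2I h3.
  have K2 : K w2.
    case/orP: h3 => [/eqP ->//|h3]; apply: connect1; rewrite es h3 fvz f2 //.
  have e12 : e w2 w1.
    by rewrite es; case/orP: h2 => // /eqP E; rewrite -E h1 in f2.
  rewrite /att; apply/andP; split; last by apply/existsP; exists w2; rewrite K2.
  by case/orP: h1 => // /eqP E; move: f2; rewrite E near1_sym // near1_edge.
have [u' [attu' attE]] : exists u', att u' /\ forall w, att w -> (w == u) || (w == u').
  case: (pickP (fun w => att w && (w != u))) => [u' /andP [au' u'u]|h].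
    exists u'; split=> // w aw; apply: contraT; rewrite negb_or => /andP [wu wu'].
    by case: (att3 attu au' aw); rewrite /= !inE !negb_or ![_ == w]eq_sym wu wu' eq_sym u'u.
  by exists u; split=> // w aw; have := h w; rewrite aw /= orbb => /negbFE.
have /andP [vu _] := attu; have /andP [vu' _] := attu'.
have Kcut x y : e x y -> ~~ ((x == u) || (x == u')) -> ~~ ((y == u) || (y == u')) -> K x = K y.
  move=> xy nx ny; apply/idP/idP => h; apply: contraT => nk.
    have /attE : att y by rewrite /att (Kext h xy nk); apply/existsP; exists x; rewrite h.
    by rewrite (negbTE ny).
  have yx : e y x by rewrite es.
  have /attE : att x by rewrite /att (Kext h yx nk); apply/existsP; exists y; rewrite h.
  by rewrite (negbTE nx).
have nKv : ~~ K v by apply/negP=> /Kfar; rewrite near1_refl.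
have fu c : (c == u) || (c == u') -> e v c by case/orP=> /eqP ->.
(* A short walk from [y] to [z] passes through [u] or [u'], which are not within distance 1 of [z];
   so the passage occurs at the first step. *)
have outK y : ~~ K y -> near1 y u || near1 y u'.
  move=> nK; have [/orP [] /eqP ->|ny] := boolP ((y == u) || (y == u')).
  - by rewrite near1_refl.
  - by rewrite near1_refl orbT.
  have nz : ~~ ((z == u) || (z == u')).
    by apply/negP=> /fu h; rewrite near1_edge in fvz.
  have [|c cu] := near3_cut Kcut (diam y z) ny nz; first by rewrite zK (negbTE nK).
  case/orP=> /andP [h1 h2]; first by case/orP: cu h1 => /eqP -> ->; rewrite ?orbT.
  by case/negP: vz; apply: near2I h2; apply: near1_edge; apply: fu.
have inK y : K y -> near2 y u || near2 y u'.
  move=> Ky; have ny : ~~ ((y == u) || (y == u')).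
    by apply/negP=> /fu h; have := Kfar Ky; rewrite near1_edge.
  have nv : ~~ ((v == u) || (v == u')).
    by rewrite negb_or !(edge_neq ei).
  have [|c cu] := near3_cut Kcut (diam y v) ny nv; first by rewrite Ky (negbTE nKv).
  by case/orP=> /andP [h1 h2]; case/orP: cu h1 => /eqP -> h; rewrite ?h ?(near12 h) ?orbT.
have [uu'|fuu'] := boolP (near1 u u').
  have cent y : near2 u y || near2 u' y.
    rewrite !(near2_sym es _ y); have [/inK //|/outK /orP [] /near12 ->] := boolP (K y) => //.
    by rewrite orbT.
  apply: Or31; case/orP: uu' => [/eqP E|uu']; last by exists u, u'.
  by exists u, v; split=> [|y]; [rewrite es|have := cent y; rewrite -E orbb => ->].
(* Here everything is within distance 2 of [b]. Outside [K] this goes through [u] or [u']; in [K] it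
   depends on the edge of the 4-cycle [u b u' v] behind which the vertex lies. *)
case: (pickP (fun b => [&& K b, e u b & e u' b])) => [b /and3P [Kb ub u'b]|no4].
  apply: Or31; exists b, u; split; first by rewrite es.
  move=> y; apply/orP; left; rewrite (near2_sym es).
  have [Ky|/outK /orP [] h] := boolP (K y); last 2 first.
  - by apply: near2I h _; apply: near1_edge.
  - by apply: near2I h _; apply: near1_edge.
  have [->|yb] := eqVneq y b; first by rewrite near12 ?near1_refl.
  have fb := Kfar Kb; have fy := Kfar Ky.
  have uv : e u v by rewrite es.
  have bu' : e b u' by rewrite es.
  have u'v : e u' v by rewrite es.
  have cc : path.cycle e [:: u; b; u'; v] by rewrite /= ub bu' u'v vu.
  have uc : uniq [:: u; b; u'; v].
    rewrite /= !inE !negb_or (edge_neq ei ub) (far_neq fuu') (edge_neq ei uv).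
    by rewrite (edge_neq ei bu') (edge_neq ei u'v) eq_sym (far_neq fb).
  have yu : y != u by apply: contraNneq fy => ->; apply: near1_edge.
  have yu' : y != u' by apply: contraNneq fy => ->; apply: near1_edge.
  have yv : y != v by rewrite eq_sym (far_neq fy).
  have yC : y \notin [:: u; b; u'; v] by rewrite !inE !negb_or yu yb yu'.
  have [i [a [a' [r [E S]]]]] := polygon_side es ei nc uc cc isT yC.
  have through w w' : e w b -> ~~ near1 w w' -> y != w -> w' != w -> w' != b ->
      side w b y != side w b w' -> near2 y b.
    move=> wb fww' yw w'w w'b ne.
    have [d dP] := side_near3 es ei nc wb (diam y w') yw yb w'w w'b ne.
    case/orP: dP => /eqP -> /orP [] /andP [h1 h2].
    - by apply: near2I h1 _; apply: near1_edge.
    - by rewrite h2 in fww'.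
    - exact: near12.
    - by [].
  have ne : u' != u by rewrite eq_sym (far_neq fuu').
  have eub := edge_neq ei ub; have eu'b := edge_neq ei u'b.
  case: i E => [|[|[|[|i]]]]; rewrite /rot /= => - [Ea Ea' Er];
    rewrite -Ea -Ea' -Er in S.
  - by apply: (through u u') => //; apply: S; rewrite !inE eqxx.
  - have h : side u' b y != side u' b u.
      by rewrite !(sideC p u'); apply: S; rewrite !inE eqxx orbT.
    by apply: (through u' u) => //; rewrite 1?near1_sym // eq_sym.
  (* An edge at [v] cannot separate [y] from [b], as both are in [K]. *)
  - have := S b; rewrite !inE eqxx orbT => /(_ isT).
    by rewrite !(sideC p u') !Kside ?eqxx.
  - have := S b; rewrite !inE eqxx => /(_ isT).
    by rewrite !Kside ?eqxx.
  - by apply: (through u u') => //; apply: S; rewrite !inE eqxx.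
case: (boolP [exists a, exists b, [&& K a, K b, e u a, e u' b & e a b]]) => [|no5].
  case/existsP=> a /existsP [b /and5P [Ka Kb ua u'b ab]]; apply: Or32; exists [:: u; a; b; u'; v].
  have n4 x : K x -> e u x -> far x u'.
    move=> Kx ux; have := no4 x; rewrite Kx ux /= => u'x.
    rewrite /near1 es u'x orbF; apply: contraNneq fuu' => <-; exact: near1_edge.
  have n4' x : K x -> e u' x -> far u x.
    move=> Kx u'x; have := no4 x; rewrite Kx u'x andbT /= => ux.
    rewrite /near1 ux orbF; apply: contraNneq fuu' => ->.
    by rewrite near1_sym // near1_edge.
  apply: (five_cycle_dominating es ei nc diam) => //; rewrite 1?es //.
  - exact: n4'.
  - exact: n4.
  - by rewrite near1_sym // Kfar.
  - by rewrite near1_sym // Kfar.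
have five a b : K a -> K b -> e u a -> e u' b -> e a b = false.
  move=> Ka Kb ua u'b; apply: contraNF no5 => ab.
  by apply/existsP; exists a; apply/existsP; exists b; rewrite Ka Kb ua u'b.
have four b : K b -> e u b -> e u' b -> False.
  by move=> Kb ub u'b; have := no4 b; rewrite Kb ub u'b.
pose path2 := [exists a, exists m, exists b,
  [&& K a, K m, K b & [&& e u a, e a m, e m b & e u' b]]].
clear no4 no5.
wlog: u u' attE attu attu' vu vu' Kcut fu outK inK fuu' five four @path2 / near2 z u.
  move=> wl; case/orP: (inK z zK) => zu; first exact: (wl u u').
  apply: (wl u' u) => //.
  - by move=> w /attE; rewrite orbC.
  - by move=> x y; rewrite !(orbC (_ == u')); apply: Kcut.
  - by move=> c; rewrite orbC; apply: fu.
  - by move=> y; rewrite orbC; apply: outK.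
  - by move=> y; rewrite orbC; apply: inK.
  - by rewrite near1_sym.
  - by move=> a b Ka Kb u'a ub; rewrite es; apply: five.
  - by move=> b Kb ? ?; apply: (four b).
move=> zu.
have fK x y : K x -> e v y -> x != y.
  by move=> Kx vy; apply: contraNneq (Kfar Kx) => ->; apply: near1_edge.
have n4 x : K x -> e u x -> far x u'.
  move=> Kx ux; apply/norP; split; first exact: fK.
  by apply/negP; rewrite es; apply: four Kx ux.
have n4' x : K x -> e u' x -> far u x.
  move=> Kx u'x; apply/norP; split; first by rewrite eq_sym; apply: fK.
  by apply/negP=> ux; apply: four Kx ux u'x.
have n5 a b : K a -> K b -> e u a -> e u' b -> far a b.
  move=> Ka Kb ua u'b; apply/norP; split; last by rewrite five.
  by apply/eqP=> E; rewrite E in Ka ua; apply: four Kb ua u'b.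
have [|no6] := boolP path2.
  case/existsP=> a /existsP [m /existsP [b /and4P [Ka Km Kb /and4P [ua am mb u'b]]]].
  apply: Or32; exists [:: u; a; m; b; u'; v].
  have fum : far u m.
    apply/norP; split; first by rewrite eq_sym; apply: fK.
    by apply/negP=> um; have := five m b Km Kb um u'b; rewrite mb.
  have fmu' : far m u'.
    apply/norP; split; first exact: fK.
    by apply/negP=> mu'; have := five a m Ka Km ua; rewrite am es mu' => /(_ isT).
  apply: (six_cycle_dominating es ei nc diam) => //; rewrite 1?es //.
  - exact: n4'.
  - exact: n5.
  - exact: n4.
  - by rewrite near1_sym // Kfar.
  - by rewrite near1_sym // Kfar.
  - by rewrite near1_sym // Kfar.
have six a m b : K a -> K m -> K b -> e u a -> e a m -> e m b -> e u' b -> False.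
  move=> Ka Km Kb ua am mb u'b; case/negP: no6; apply/existsP; exists a; apply/existsP.
  by exists m; apply/existsP; exists b; rewrite Ka Km Kb ua am mb u'b.
have Knbr x y : K x -> e x y -> far v y -> K y.
  by move=> Kx xy fy; apply: (connect_trans Kx); apply: connect1; rewrite xy fy Kfar.
have fzc c : e v c -> far z c.
  by move=> vc; apply: contra vz => h; apply: near2I (near1_edge vc) _; rewrite near1_sym.
have [a [Ka ua az]] : exists a, [/\ K a, e u a & e a z].
  case/existsP: zu => a /andP [za au]; exists a.
  have fva : far v a.
    by apply: contra vz => h; apply: near2I h _; rewrite near1_sym.
  have za' : e z a.
    by case/orP: za => // /eqP E; move: (fzc u vu); rewrite E au.
  have ua : e u a.
    by rewrite es; case/orP: au => // /eqP E; move: fva; rewrite E near1_edge.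
  by split; rewrite // 1?es //; apply: Knbr za' fva.
(* If [w2] is in [K], this walk closes up through [v], [u] and [a] to the 7-cycle. Otherwise [w2] is
   [u] or [u']: the first would make [u] and [u'] adjacent, the second gives a path excluded by
   [six]. *)
have [w1 [w2 [h1 h2 h3]]] := near3P _ _ _ (diam z u').
have fvw1 : far v w1.
  by apply: contra vz => h; apply: near2I h _; rewrite near1_sym.
have Kw1 : K w1 by case/orP: h1 => [/eqP <- //|h1]; apply: Knbr h1 fvw1.
have [fvw2|nvw2] := boolP (near1 v w2); last first.
  have Kw2 : K w2 by case/orP: h2 => [/eqP <- //|h2]; apply: Knbr h2 nvw2.
  have u'w2 : e u' w2.
    by rewrite es; case/orP: h3 => // /eqP E; move: (fK w2 u' Kw2 vu'); rewrite E eqxx.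
  have nzw2 : e z w2 = false.
    by apply/negP=> zw2; apply: (six a z w2).
  have zw2 : z != w2.
    by apply: contraNneq (fzc u' vu') => ->; rewrite near1_sym // near1_edge.
  have zw1 : e z w1.
    case/orP: h1 => // /eqP E; move: h2; rewrite -E.
    by rewrite /near1 nzw2 (negbTE zw2).
  have w12 : e w1 w2.
    by case/orP: h2 => // /eqP E; rewrite E nzw2 in zw1.
  apply: Or33; exists [:: u; a; z; w1; w2; u'; v].
  have w1a : e w1 u = false.
    by apply/negP=> w1u; have := five w1 w2 Kw1 Kw2; rewrite w12 es w1u => /(_ isT u'w2).
  apply: (seven_cycle_spanning es ei nc diam) => //; rewrite 1?es //.
  - by rewrite near1_sym //; apply: fzc.
  - apply/norP; split; last by apply/negP=> aw; apply: (six a w1 w2).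
    by apply: contraFneq w1a => <-; rewrite es.
  - by apply/norP; rewrite nzw2.
  - by apply/norP; split; [exact: fK|apply/negP=> w1u'; apply: (six a z w1); rewrite // es].
  - by rewrite near1_sym // Kfar.
  - by rewrite near1_sym.
  - exact: Kfar.
  - by apply/norP; rewrite eq_sym fK // es w1a.
  - exact: n5.
  - exact: fzc.
  - by rewrite near1_sym.
  - by rewrite near1_sym // n4'.
  - by rewrite near1_sym // n4.
have vw2 : e v w2.
  by case/orP: fvw2 => // /eqP E; rewrite -E near1_sym // (negbTE fvw1) in h2.
have w12 : e w1 w2.
  by case/orP: h2 => // /eqP E; rewrite E near1_edge in fvw1.
have : att w2 by rewrite /att vw2; apply/existsP; exists w1; rewrite Kw1.
case/attE/orP => /eqP E; first by rewrite -E h3 in fuu'.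
have zw1 : e z w1.
  by case/orP: h1 => // /eqP E'; have := fzc u' vu'; rewrite E' -E near1_edge.
by case: (six a z w1); rewrite // -?E es.
Qed.

End FarComponent.
End Trichotomy.

(** * Rainbow colourings from dominating sets *)

Section Rainbow.
Variables (T : finType) (e : rel T).
Hypotheses (es : symmetric e) (ei : irreflexive e).
Implicit Types (c : T -> T -> nat) (D : {set T}).

Definition rainbow_path c x y q :=
  [/\ path e x q, last x q = y, uniq (x :: q) & uniq (pairmap c x q)].

(** Colours are natural numbers bounded only on edges inside [D], so a colouring can be extended
    beyond [D] by the new colours [k], [k + 1] and so on. *)
Definition rainbow_on D k := exists c : T -> T -> nat,
  [/\ forall x y, c x y = c y x,
      {in D &, forall x y, e x y -> c x y < k} &
      {in D &, forall x y, exists q, rainbow_path c x y q /\ {subset q <= D}}].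

Lemma pairmap_agree c c' D x q : {in D &, c =2 c'} -> x \in D -> {subset q <= D} ->
  pairmap c x q = pairmap c' x q.
Proof.
move=> cc'; elim: q x => //= y q IH x xD qD.
have yD : y \in D by apply: qD; rewrite mem_head.
by rewrite cc' // IH // => z zq; apply: qD; rewrite inE zq orbT.
Qed.

Lemma pairmap_lt c D k x q : {in D &, forall x y, e x y -> c x y < k} ->
  path e x q -> x \in D -> {subset q <= D} -> all (fun m => m < k) (pairmap c x q).
Proof.
move=> ck; elim: q x => //= y q IH x /andP [xy pq] xD qD.
have yD : y \in D by apply: qD; rewrite mem_head.
by rewrite ck // IH // => z zq; apply: qD; rewrite inE zq orbT.
Qed.

Lemma all_lt_notin k j s : all (fun m => m < k) s -> k <= j -> j \notin s.
Proof. by move=> /allP h kj; apply/negP=> /h; rewrite ltnNge kj. Qed.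

Lemma rainbow_on_leq D j k : j <= k -> rainbow_on D j -> rainbow_on D k.
Proof.
move=> jk [c [cs cj cr]]; exists c; split=> // x y xD yD xy.
exact: leq_trans (cj x y xD yD xy) jk.
Qed.

Lemma rainbow_on1 x : rainbow_on [set x] 0.
Proof.
exists (fun _ _ => 0); split=> // y z /set1P -> /set1P ->; first by rewrite ei.
by exists [::]; split.
Qed.

(** All edges at [a] get the new colour [k]; a path ending at [a] uses only one of them. *)
Lemma rainbow_on_pendant D k a d :
  rainbow_on D k -> a \notin D -> d \in D -> e d a -> rainbow_on (a |: D) k.+1.
Proof.
move=> [c [cs ck cr]] aD dD da.
pose c' x y := if (x == a) || (y == a) then k else c x y.
have na x : x \in D -> x == a = false by move=> xD; apply: contraNF aD => /eqP <-.
have cc' : {in D &, c =2 c'} by move=> x y xD yD; rewrite /c' !na.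
have sub (q : seq T) : {subset q <= D} -> {subset q <= a |: D}.
  by move=> qD x /qD; rewrite inE orbC => ->.
have anotin (q : seq T) : {subset q <= D} -> a \notin q.
  by move=> qD; apply: contra aD; apply: qD.
exists c'; split.
- by move=> x y; rewrite /c' orbC cs.
- move=> x y; rewrite !inE /c'; case: (x == a) => //=; case: (y == a) => //= xD yD xy.
  exact/leqW/ck.
move=> x y /setU1P [->|xD] /setU1P [->|yD].
- by exists [::]; split.
- have [q [[pq lq uq cq] qD]] := cr d y dD yD.
  exists (d :: q); split; last by apply: sub => z /predU1P [->|/qD].
  split=> //=.
  + by rewrite es da.
  + by rewrite anotin //= => z /predU1P [->|/qD].
  + rewrite -(pairmap_agree cc' dD qD) cq andbT /c' eqxx.
    exact: all_lt_notin (pairmap_lt ck pq dD qD) _.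
- have [q [[pq lq uq cq] qD]] := cr x d xD dD.
  exists (rcons q a); split; last first.
    by move=> z; rewrite mem_rcons => /predU1P [->|/qD zD]; rewrite !inE ?eqxx ?zD ?orbT.
  split=> //.
  + by rewrite rcons_path pq lq.
  + by rewrite last_rcons.
  + by rewrite -rcons_cons rcons_uniq uq andbT anotin // => z /predU1P [->|/qD].
  + rewrite -cats1 pairmap_cat lq /= cats1 rcons_uniq -(pairmap_agree cc' xD qD) cq andbT.
    by rewrite /c' eqxx orbT; apply: all_lt_notin (pairmap_lt ck pq xD qD) _.
- have [q [[pq lq uq cq] qD]] := cr x y xD yD.
  by exists q; split; [split=> //; rewrite -(pairmap_agree cc' xD qD)|exact: sub].
Qed.

Lemma rainbow_on_edge_neighbours a b (A : {set T}) : e a b -> #|A| <= 2 ->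
  {in A, forall x, [&& x != a, x != b & e x a || e x b]} ->
  rainbow_on ([set a; b] :|: A) 3.
Proof.
move=> ab A2 AN.
have r1 : rainbow_on [set a; b] 1.
  rewrite setUC; apply: (rainbow_on_pendant (d := a)) => //; first exact: rainbow_on1.
    by rewrite inE; apply: contraTneq ab => ->; rewrite ei.
  by rewrite inE.
have pend k (D : {set T}) x : rainbow_on D k -> [set a; b] \subset D -> x \in A -> x \notin D ->
    rainbow_on (x |: D) k.+1.
  move=> rD /subsetP abD xA xD; have /and3P [_ _ /orP [h|h]] := AN _ xA.
    by apply: (rainbow_on_pendant (d := a)) => //; rewrite 1?es // abD // !inE eqxx.
  by apply: (rainbow_on_pendant (d := b)) => //; rewrite 1?es // abD // !inE eqxx orbT.
have nab x : x \in A -> x \notin [set a; b].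
  by move=> /AN /and3P [xa xb _]; rewrite !inE negb_or xa.
move: A2; rewrite leq_eqVlt ltnS leq_eqVlt ltnS leqn0 cards_eq0.
case/or3P=> [/cards2P [x [y [xy EA]]]|/cards1P [x EA]|/eqP ->].
- have [xA yA] : x \in A /\ y \in A by rewrite EA !inE !eqxx orbT.
  rewrite EA setUC -setUA; apply: (pend) => //.
  + by apply: (pend) => //; apply: nab.
  + exact: subsetUr.
  + by rewrite inE negb_or nab // inE xy.
- have xA : x \in A by rewrite EA inE.
  by rewrite EA setUC; apply/(rainbow_on_leq (leqnSn _))/pend; rewrite ?nab.
- by rewrite setU0; apply: rainbow_on_leq r1.
Qed.

(* Colours [k], [k+1] are used between [D] and its complement, [k+2] outside [D], in such a
   way that from every outside vertex [D] can be reached with last colour [k] as well as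
   with last colour [k+1]: the vertices outside [D] are split by a maximal independent set
   [X], and those with no neighbour outside [D] have two neighbours in [D]. *)
Lemma rainbow_on_dominating D k : rainbow_on D k -> dominating e D ->
  (forall x y, e x y -> exists z, e x z /\ z != y) -> rainbow_on setT (k + 3).
Proof.
move=> [c [cs ck cr]] dom deg2.
pose P (X : {set T}) := (X \subset ~: D) && [forall x in X, forall y in X, ~~ e x y].
have P0 : P set0.
  by rewrite /P sub0set; apply/forall_inP=> x; rewrite inE.
have [X /maxsetP [/andP [XD /forall_inP Xind] Xmax] _] := maxset_exists P0.
pose acc x := [exists y, (y \notin D) && e x y].
pose d0 x := odflt x [pick d in D | e x d].
(* The edge from an outside vertex [x] to [d] gets colour [k + f x d]. With a neighbour outside [D]
   the colour records membership in [X]; otherwise the edge to [d0 x] is told apart from the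
   others. *)
pose f x d := if acc x then x \in X else d != d0 x.
have d0P x : x \notin D -> d0 x \in D /\ e x (d0 x).
  move=> /dom [d dD xd]; rewrite /d0; case: pickP => [d' /andP [] //|/(_ d)].
  by rewrite dD xd.
have exit x (b : bool) : x \notin D ->
    (exists d, [/\ d \in D, e x d & f x d = b]) \/
    exists x' d, [/\ x' \notin D, e x x', d \in D, e x' d & f x' d = b].
  move=> xD; have [d0D xd0] := d0P x xD; rewrite /f; case ax : (acc x).
    have [<-|xb] := eqVneq (x \in X) b; first by left; exists (d0 x).
    (* Independence of [X] gives the outside neighbour when [x] is in [X], maximality when it is
       not. *)
    right; have [x' [x'D xx' x'b]] : exists x', [/\ x' \notin D, e x x' & (x' \in X) = b].
      case xX : (x \in X) in xb; case: b xb => // _.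
        case/existsP: ax => x' /andP [x'D xx']; exists x'; split=> //.
        by apply: contraTF xx' => x'X; apply: (forall_inP (Xind x xX)).
      have : ~~ P (x |: X).
        apply/negP=> /Xmax /(_ (subsetUr _ _)) /setP /(_ x).
        by rewrite !inE eqxx xX.
      rewrite /P subUset sub1set inE xD XD /=.
      have nb y : y \in X -> e x y -> exists x', [/\ x' \notin D, e x x' & (x' \in X) = true].
        by move=> yX xy; exists y; have := subsetP XD _ yX; rewrite inE.
      case/forall_inPn=> y /setU1P yX /forall_inPn [w /setU1P wX]; rewrite negbK => yw.
      case: yX yw => [->|yX]; case: wX => [->|wX]; rewrite ?ei //.
      - exact: nb.
      - by rewrite es; apply: nb.
      - by rewrite (negbTE (forall_inP (Xind y yX) _ wX)).
    have [d dD x'd] := dom _ x'D; exists x', d; split=> //.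
    suff -> : acc x' by [].
    by apply/existsP; exists x; rewrite xD es.
  case: b; last by left; exists (d0 x); rewrite eqxx.
  have [z [xz zd]] := deg2 _ _ xd0; left; exists z; split=> //.
  by apply: contraFT ax => zD; apply/existsP; exists z; rewrite zD.
pose c' x y := if x \in D then (if y \in D then c x y else k + f y x)
               else if y \in D then k + f x y else k + 2.
have cc' : {in D &, c =2 c'} by move=> x y xD yD; rewrite /c' xD yD.
have c'lt x y : e x y -> c' x y < k + 3.
  rewrite /c'; case: ifP => xD; case: ifP => yD xy; rewrite ?ltn_add2l //.
  - by apply: ltn_addr; apply: ck.
  - by case: (f _ _).
  - by case: (f _ _).
(* All these paths enter [y] by the same edge, so [b] does not depend on [d]. *)
have core y : y \notin D -> exists b : bool, forall d, d \in D -> exists q,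
    [/\ rainbow_path c' d y q, {subset d :: q <= y |: D} &
        all (fun m => (m < k) || (m == k + b)) (pairmap c' d q)].
  move=> yD; have [d' d'D yd'] := dom y yD; exists (f y d') => d dD.
  have [q [[pq lq uq cq] qD]] := cr d d' dD d'D.
  have dqD : {subset d :: q <= D} by move=> z /predU1P [->|/qD].
  have lt := pairmap_lt ck pq dD qD.
  have E : pairmap c' d (rcons q y) = rcons (pairmap c d q) (k + f y d').
    by rewrite -cats1 pairmap_cat lq /= cats1 -(pairmap_agree cc' dD qD) /c' d'D (negbTE yD).
  exists (rcons q y); split.
  - split.
    + by rewrite rcons_path pq lq es.
    + by rewrite last_rcons.
    + by rewrite -rcons_cons rcons_uniq uq andbT; apply: contra yD; apply: dqD.
    + by rewrite E rcons_uniq cq andbT (all_lt_notin lt) // leq_addr.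
  - move=> z; rewrite -rcons_cons mem_rcons => /predU1P [->|/dqD zD]; rewrite !inE ?eqxx ?zD ?orbT //.
  - rewrite E all_rcons eqxx orbT /=; apply: sub_all lt => m ->; exact: isT.
exists c'; split.
- by move=> x y; rewrite /c'; case: (x \in D); case: (y \in D).
- by move=> x y _ _; apply: c'lt.
move=> x y _ _; suff [q h] : exists q, rainbow_path c' x y q by exists q; split=> // z _; rewrite inE.
have [xD|xD] := boolP (x \in D); have [yD|yD] := boolP (y \in D).
- have [q [[pq lq uq cq] qD]] := cr x y xD yD.
  by exists q; split; rewrite -?(pairmap_agree cc' xD qD).
- by have [b h] := core y yD; have [q [h' _ _]] := h x xD; exists q.
- have [d0D xd0] := d0P x xD; have [q [[pq lq uq cq] qD]] := cr _ y d0D yD.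
  exists (d0 x :: q); split=> //; first by rewrite /= xd0.
    rewrite cons_uniq uq andbT; apply: contra xD => /predU1P [->//|]; exact: qD.
  rewrite /= -(pairmap_agree cc' d0D qD) cq andbT /c' (negbTE xD) d0D.
  by rewrite (all_lt_notin (pairmap_lt ck pq d0D qD)) // leq_addr.
have [->|xy] := eqVneq x y; first by exists [::].
have [exy|nxy] := boolP (e x y).
  by exists [:: y]; split; rewrite /= ?inE ?exy ?xy.
have [b hb] := core y yD.
have notin z d q : z \notin D -> z != y -> {subset d :: q <= y |: D} -> z \notin d :: q.
  by move=> zD zy sub; apply/negP=> /sub; rewrite inE (negbTE zD) inE (negbTE zy).
have colour m s : all (fun m => (m < k) || (m == k + b)) s -> k <= m -> m != k + b -> m \notin s.
  by move=> /allP h km mb; apply/negP=> /h; rewrite ltnNge km (negbTE mb).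
have bb : k + ~~ b != k + b by rewrite eqn_add2l; case: (b).
case: (exit x (~~ b) xD) => [[d [dD xd fd]]|[x' [d [x'D xx' dD x'd fd]]]];
  have [q [[pq lq uq cq] sub col]] := hb d dD.
- exists (d :: q); split=> //.
  + by rewrite /= xd.
  + by rewrite cons_uniq uq andbT; apply: notin.
  + by rewrite /= cq andbT /c' (negbTE xD) dD fd; apply: colour; rewrite ?leq_addr.
have x'y : x' != y by apply: contraNneq nxy => <-.
have nx'x : x != x' by apply: contraTneq xx' => <-; rewrite ei.
exists [:: x', d & q]; split=> //.
+ by rewrite /= xx' x'd.
+ by rewrite 2!cons_uniq uq andbT (notin x') // andbT inE negb_or nx'x notin.
+ rewrite /= cq andbT /c' (negbTE xD) (negbTE x'D) dD fd inE negb_or.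
  rewrite eqn_add2l; apply/andP; split; last by apply: colour; rewrite ?leq_addr.
  apply/andP; split; first by case: (b).
  by apply: colour; rewrite ?leq_addr // eqn_add2l; case: (b).
Qed.

End Rainbow.

(** * Rainbow colourings of cycles, and the theorem *)

(* The [k]-cycle on [0 .. k-1] with its edges coloured [0, 1, .., m-1, 0, 1, ..] in turn, and
   the shorter of its two arcs from [i] to [j]. *)
Definition cycle_colour k m i j :=
  if maxn i j == (minn i j).+1 then minn i j %% m else k.-1 %% m.

Definition cycle_arc k i j :=
  let s := (j + k - i) %% k in
  if s.*2 <= k then [seq (i + t) %% k | t <- iota 1 s]
  else [seq (i + k - t) %% k | t <- iota 1 (k - s)].

Definition cycle_step k i j := (j == i.+1 %% k) || (i == j.+1 %% k).

(** A closed Boolean test, evaluated for lengths 5 and 6 with three colours and length 7 with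
    four. *)
Definition cycle_rainbow k m :=
  all (fun i => all (fun j => let q := cycle_arc k i j in
    [&& path (cycle_step k) i q, last i q == j, all (fun l => l < k) q, uniq (i :: q)
      & uniq (pairmap (cycle_colour k m) i q)]) (iota 0 k)) (iota 0 k).

Section Final.
Variables (T : finType) (e : rel T).
Hypotheses (es : symmetric e) (ei : irreflexive e).

Lemma nth_cycle_step x0 s i j : path.cycle e s -> i < size s -> j < size s ->
  cycle_step (size s) i j -> e (nth x0 s i) (nth x0 s j).
Proof.
move=> cs; wlog: i j / j == i.+1 %% size s => [wl li lj /orP [h|h]|].
- by apply: wl; rewrite // /cycle_step h.
- by rewrite es; apply: wl; rewrite // /cycle_step h.
case: s cs => // x s /(pathP x0); rewrite size_rcons => cs /eqP -> li _ _.
have := cs i li; rewrite -rcons_cons nth_rcons /= li nth_rcons.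
have := li; rewrite /= leq_eqVlt ltnS => /orP [/eqP [->]|h].
  by rewrite ltnn eqxx modnn.
by rewrite modn_small // h.
Qed.

Lemma rainbow_on_cycle s m : uniq s -> path.cycle e s -> 0 < m ->
  cycle_rainbow (size s) m -> rainbow_on e [set x in s] m.
Proof.
move=> us cs m0 /allP ok; pose k := size s.
exists (fun x y => cycle_colour k m (index x s) (index y s)); split.
- by move=> x y; rewrite /cycle_colour maxnC minnC.
- by move=> x y _ _ _; rewrite /cycle_colour; case: ifP => _; apply: ltn_pmod.
move=> x y; rewrite !inE => xs ys.
have [li lj] : index x s < k /\ index y s < k by rewrite !index_mem.
have := ok (index x s); rewrite mem_iota => /(_ li) /allP /(_ (index y s)).
rewrite mem_iota => /(_ lj) /and5P []; set q := cycle_arc _ _ _.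
set i := index x s in li *; have -> : x = nth x s i by rewrite nth_index.
move=> pq /eqP lq qk uq cq; have -> : y = nth x s (index y s) by rewrite nth_index.
exists [seq nth x s l | l <- q]; split; last first.
  by move=> z /mapP [l /(allP qk) lk ->]; rewrite inE mem_nth.
have qk' : all (fun l => l < k) (i :: q) by rewrite /= li.
split.
- elim: q i pq qk' {li lq qk uq cq} => //= l q IH i /andP [il pq] /and3P [ik lk qk].
  by rewrite IH ?lk // andbT; apply: nth_cycle_step.
- by rewrite last_map lq.
- rewrite -map_cons map_inj_in_uniq // => a b /(allP qk') ak /(allP qk') bk /eqP.
  by rewrite nth_uniq // => /eqP.
- suff -> : pairmap (fun x y => cycle_colour k m (index x s) (index y s))
      (nth x s i) [seq nth x s l | l <- q] = pairmap (cycle_colour k m) i q by [].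
  elim: q i qk' {li lq qk uq cq pq} => //= l q IH i /and3P [ik lk qk].
  by rewrite IH ?lk // !index_uniq.
Qed.

Lemma path_coloursE k (c : T -> T -> 'I_k) x q : path_colours c x q = pairmap c x q.
Proof. by elim: q x => //= y q IH x; rewrite -IH. Qed.

Lemma rainbow_on_colourable k n : k <= n.+1 -> rainbow_on e setT k -> rc_colourable e n.+1.
Proof.
move=> kn [c [cs ck cr]]; exists (fun x y => inord (c x y)); split.
  by move=> x y _; rewrite cs.
move=> x y; have [q [[pq lq uq cq] _]] := cr x y (in_setT x) (in_setT y).
exists q; rewrite /walk pq lq eqxx uq; split=> //; split=> //.
have lt := pairmap_lt ck pq (in_setT x) (fun z _ => in_setT z).
have -> : path_colours (fun x y => inord (c x y) : 'I_n.+1) x q = map inord (pairmap c x q).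
  by rewrite path_coloursE; elim: (q) (x) => //= z r IH w; rewrite IH.
rewrite map_inj_in_uniq // => a b /(allP lt) ak /(allP lt) bk E.
by have := congr1 val E; rewrite /= !inordK ?(leq_trans ak) ?(leq_trans bk).
Qed.

(** A rainbow path has at most as many edges as there are colours; this yields the lower bound. *)
Lemma rc_colourable_dist_le k x y : rc_colourable e k -> dist_le e x y k.
Proof.
case=> c [_ rb]; have [q [wq [_ uq]]] := rb x y; exists q; split=> //.
have := max_card (mem (path_colours c x q)).
by rewrite card_ord (card_uniqP uq) path_coloursE size_pairmap.
Qed.

End Final.

(** The detour around the edge [xy] leaves [x] by another edge. *)
Lemma bridgeless_other_neighbour (T : finType) (e : rel T) x y :
  irreflexive e -> bridgeless e -> e x y -> exists z, e x z /\ z != y.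
Proof.
move=> ei eb xy; have /connectP [[|z q] /=] := eb _ _ xy.
  by move=> _ E; rewrite E ei in xy.
case/andP=> /andP [xz]; rewrite eqxx /= negb_or => /andP [zy _] _ _.
by exists z.
Qed.

Lemma outerplanar_colourable (T : finType) (e : rel T) :
  simple_graph e -> connected_graph e -> bridgeless e -> outerplanar e ->
  (forall x y, dist_le e x y 3) -> rc_colourable e 6.
Proof.
move=> sg ec eb eo diam; have [p nc] := outerplanar_noncrossing sg ec eb eo.
have [es ei] := sg; have near x y := dist_le_near3 (diam x y).
have deg2 x y : e x y -> exists z, e x z /\ z != y by exact: bridgeless_other_neighbour.
have dom (D : {set T}) : rainbow_on e D 3 -> dominating e D -> rc_colourable e 6.
  by move=> r d; apply: (rainbow_on_colourable (k := 6)) => //; apply: (rainbow_on_dominating es ei r).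
have cyc c m : uniq c -> path.cycle e c -> 0 < m -> cycle_rainbow (size c) m ->
    rainbow_on e [set x in c] m.
  exact: rainbow_on_cycle.
have centre a b : edge_centre e a b -> rc_colourable e 6.
  move=> ab; have [A [A2 domA AN]] := edge_centre_dominating es ei nc near ab.
  by apply: dom domA; apply: rainbow_on_edge_neighbours; case: ab.
(* If all distances are at most 2, every edge is central; a dart of the outer face supplies one. *)
have [|no] := boolP [exists v, exists z, ~~ near2 e v z]; last first.
  have [rot [_ [[v w] [vw _]]]] := eo; apply: (centre v w); split=> // y.
  by move/existsPn: no => /(_ v) /existsPn /(_ y); rewrite negbK => ->.
case/existsP=> v /existsP [z vz].
have [[a [b ab]]|[c [uc cc sc domc]]|[c [uc cc sc allc]]] :=
  far_vertex_trichotomy es ei nc near vz.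
- exact: centre ab.
- by apply: dom domc; apply: cyc => //; case/orP: sc => /eqP ->; vm_compute.
- apply: (rainbow_on_colourable (k := 4)) => //.
  have -> : setT = [set x in c] by apply/setP=> x; rewrite !inE allc.
  by apply: cyc => //; rewrite sc; vm_compute.
Qed.

Theorem theorem3 (T : finType) (e : rel T) :
  simple_graph e -> connected_graph e -> bridgeless e -> outerplanar e ->
  diameter_eq e 3 ->
  exists k, is_rc e k /\ 3 <= k <= 6.
Proof.
move=> sg ec eb eo [diam [[x [y far]] _]].
have c6 := outerplanar_colourable sg ec eb eo diam.
(* The least number of colours exists by strong induction, with excluded middle because
   [rc_colourable] is a proposition. *)
have least n : rc_colourable e n -> exists2 k, is_rc e k & k <= n.
  elim/ltn_ind: n => n IH cn.
  have [[j [jn cj]]|no] := classic (exists j, j < n /\ rc_colourable e j).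
    by have [k rk kj] := IH j jn cj; exists k; rewrite // (leq_trans kj) // ltnW.
  by exists n => //; split=> // j jn cj; apply: no; exists j.
have [k rk k6] := least 6 c6; exists k; rewrite k6 andbT; split=> //.
rewrite leqNgt; apply/negP=> k3; apply: far; have [ck _] := rk.
have [q [wq sq]] := rc_colourable_dist_le x y ck.
by exists q; split=> //; apply: leq_trans sq _.
Qed.
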